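(* Let $R$ be a commutative noetherian ring of (finite) Krull dimension $d$. If for each prime ideal $\mathfrak p$ in $R$ there exists an integer $s\le \dim (R/\mathfrak p)+1$ such that $\mathsf{ca}^{s}(R/\mathfrak p)\neq 0$, then there exist a finitely generated $R$-module $G$ and an integer $n$ such that $\Omega^{d}_{R}(\mathrm{mod}\,R)\subseteq|G|_{n}$.
   Context: For a commutative noetherian ring $R$, $\mathrm{mod}\,R$ is the category of finitely generated $R$-modules. For $n\ge 0$, $\mathsf{ca}^{n}(R)$ is the ideal of all $a\in R$ with $a\,\mathrm{Ext}^{i}_{R}(M,N)=0$ for all $M,N\in\mathrm{mod}\,R$ and all $i\ge n$. Syzygies: $\Omega_{R}M$ is the kernel of a surjection $P\to M$ with $P$ a finitely generated projective module; $\Omega^{0}M=M$ and $\Omega^{n}M=\Omega(\Omega^{n-1}M)$. Syzygies are defined up to projective summands. $\Omega^{d}_{R}(\mathrm{mod}\,R)=\{\Omega^{d}_{R}M\mid M\in\mathrm{mod}\,R\}$. For $G\in\mathrm{mod}\,R$, $\mathrm{add}\,G$ consists of direct summands of finite direct sums of copies of $G$; $|G|_{0}=\{0\}$, $|G|_{1}=\mathrm{add}\,G$, and for $n\ge 2$, $|G|_{n}$ consists of the $M\in\mathrm{mod}\,R$ that fit into an exact sequence $0\to Y\to M\oplus W\to X\to 0$ with $Y\in|G|_{n-1}$ and $X\in\mathrm{add}\,G$ (for some $W\in\mathrm{mod}\,R$). *)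

(* Defs.v *)
From HB Require Import structures.
From mathcomp Require Import all_boot all_algebra.
From mathcomp Require Import boolp classical_sets.

Set Implicit Arguments.
Unset Strict Implicit.
Unset Printing Implicit Defensive.

Import GRing.Theory.
Local Open Scope ring_scope.
Local Open Scope quotient_scope.

Section QuotientModule.
Variables (R : pzRingType) (V : lmodType R) (S : submodClosed V).

Let submod_oppr_closed : oppr_closed (S : {pred V}).
Proof. by move=> x xS; rewrite -scaleN1r rpredZ. Qed.

Definition submod_zmodClosed : zmodClosed V :=
  HB.pack_for (zmodClosed V) (GRing.SubmodClosed.sort S)
    (GRing.isOppClosed.Build V (GRing.SubmodClosed.sort S) submod_oppr_closed).

Definition quot_mod : Type := Quotient.quot submod_zmodClosed.
HB.instance Definition _ := GRing.Zmodule.on quot_mod.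

Definition quot_proj (v : V) : quot_mod := \pi_(Quotient.quot submod_zmodClosed) v.

Definition quot_scale (a : R) (x : quot_mod) : quot_mod :=
  quot_proj (a *: repr (x : Quotient.quot submod_zmodClosed)).

Lemma quot_projZ a v : quot_scale a (quot_proj v) = quot_proj (a *: v).
Proof.
apply/eqP; rewrite -(Quotient.idealrBE submod_zmodClosed) -scalerBr.
by apply: rpredZ; rewrite (Quotient.idealrBE submod_zmodClosed) reprK.
Qed.

Lemma quot_projP (x : quot_mod) : exists v, x = quot_proj v.
Proof. by exists (repr (x : Quotient.quot submod_zmodClosed)); rewrite /quot_proj reprK. Qed.

Lemma quot_projD u v : quot_proj (u + v) = quot_proj u + quot_proj v.
Proof. exact: (raddfD (\pi_(Quotient.quot submod_zmodClosed))). Qed.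

Let quot_scaleA a b x : quot_scale a (quot_scale b x) = quot_scale (a * b) x.
Proof. by have [v ->] := quot_projP x; rewrite !quot_projZ scalerA. Qed.

Let quot_scale1 : left_id 1 quot_scale.
Proof. by move=> x; have [v ->] := quot_projP x; rewrite quot_projZ scale1r. Qed.

Let quot_scaleDr : right_distributive quot_scale +%R.
Proof.
move=> a x y; have [u ->] := quot_projP x; have [v ->] := quot_projP y.
by rewrite -quot_projD !quot_projZ -quot_projD scalerDr.
Qed.

Let quot_scaleDl x : {morph quot_scale^~ x : a b / a + b}.
Proof.
move=> a b; have [v ->] := quot_projP x.
by rewrite !quot_projZ -quot_projD scalerDl.
Qed.

HB.instance Definition _ := GRing.Zmodule_isLmodule.Build R quot_mod
  quot_scaleA quot_scale1 quot_scaleDr quot_scaleDl.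

Lemma quot_proj_eq0 v : (quot_proj v == 0) = (v \in S).
Proof.
rewrite -[v in RHS]subr0 [RHS](Quotient.idealrBE submod_zmodClosed).
by rewrite (raddf0 (\pi_(Quotient.quot submod_zmodClosed))).
Qed.
End QuotientModule.

(* The R-module of R-linear maps from U to V, with pointwise operations. *)
Section HomModule.
Variables (R : comNzRingType) (U V : lmodType R).

Definition hom_mod : Type := {linear U -> V}.
Definition hom_fun (f : hom_mod) : {linear U -> V} := f.

HB.instance Definition _ := gen_eqMixin hom_mod.
HB.instance Definition _ := gen_choiceMixin hom_mod.

Lemma hom_modP (f g : hom_mod) : hom_fun f =1 hom_fun g -> f = g.
Proof.
move: f g => [f [[fD] [fZ]]] [g [[gD] [gZ]]] /= fg.
have {}fg : f = g by apply/funext.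
by subst g; rewrite (Prop_irrelevance gD fD) (Prop_irrelevance gZ fZ).
Qed.

Definition hom_zero : hom_mod := (\0 : {linear U -> V}).
Definition hom_opp (f : hom_mod) : hom_mod := (\- hom_fun f : {linear U -> V}).
Definition hom_add (f g : hom_mod) : hom_mod :=
  (hom_fun f \+ hom_fun g : {linear U -> V}).
Definition hom_scale (a : R) (f : hom_mod) : hom_mod :=
  (a \*: hom_fun f : {linear U -> V}).

Let addA : associative hom_add.
Proof. by move=> f g h; apply: hom_modP => x /=; rewrite addrA. Qed.
Let addC : commutative hom_add.
Proof. by move=> f g; apply: hom_modP => x /=; rewrite addrC. Qed.
Let add0 : left_id hom_zero hom_add.
Proof. by move=> f; apply: hom_modP => x /=; rewrite add0r. Qed.
Let addN : left_inverse hom_zero hom_opp hom_add.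
Proof. by move=> f; apply: hom_modP => x /=; rewrite addNr. Qed.

HB.instance Definition _ := GRing.isZmodule.Build hom_mod addA addC add0 addN.

Let scaleA a b f : hom_scale a (hom_scale b f) = hom_scale (a * b) f.
Proof. by apply: hom_modP => x /=; rewrite scalerA. Qed.
Let scale1 : left_id 1 hom_scale.
Proof. by move=> f; apply: hom_modP => x /=; rewrite scale1r. Qed.
Let scaleDr : right_distributive hom_scale +%R.
Proof. by move=> a f g; apply: hom_modP => x /=; rewrite scalerDr. Qed.
Let scaleDl f : {morph hom_scale^~ f : a b / a + b}.
Proof. by move=> a b; apply: hom_modP => x /=; rewrite scalerDl. Qed.

HB.instance Definition _ := GRing.Zmodule_isLmodule.Build R hom_mod
  scaleA scale1 scaleDr scaleDl.
End HomModule.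

Section Precomposition.
Variables (R : comNzRingType) (U U' V : lmodType R) (h : {linear U' -> U}).

Definition precomp (f : hom_mod U V) : hom_mod U' V :=
  (hom_fun f \o h : {linear U' -> V}).

Let precomp_linear : linear precomp.
Proof. by move=> a f g; apply: hom_modP. Qed.

HB.instance Definition _ :=
  GRing.isLinear.Build R (hom_mod U V) (hom_mod U' V) *:%R
    precomp precomp_linear.
End Precomposition.

(* The homology ker g / im f at B of A -f-> B -g-> C.  No relation g \o f = 0
   is required here: the quotient is by the preimage of im f in ker g. *)
Section Homology.
Variables (R : pzRingType) (A B C : lmodType R).
Variables (f : {linear A -> B}) (g : {linear B -> C}).

Definition cycle_pred : {pred B} := fun x => g x == 0.

Let cycle_closed : submod_closed cycle_pred.
Proof.
split=> [|a x y]; rewrite !unfold_in ?raddf0 //.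
by move=> /eqP gx /eqP gy; rewrite linearP gx gy scaler0 addr0.
Qed.
HB.instance Definition _ :=
  GRing.isSubmodClosed.Build R B cycle_pred cycle_closed.

Record cycles : Type := Cycle { cycle_val :> B; _ : cycle_val \in cycle_pred }.
HB.instance Definition _ := [isSub for cycle_val].
HB.instance Definition _ := [Choice of cycles by <:].
HB.instance Definition _ := [SubChoice_isSubLmodule of cycles by <:].

Definition boundary_pred : {pred cycles} :=
  fun x => `[< exists y, f y = val x >].

Let boundary_closed : submod_closed boundary_pred.
Proof.
split=> [|a x y]; first by apply/asboolP; exists 0; rewrite !raddf0.
move=> /asboolP[u fu] /asboolP[v fv]; apply/asboolP; exists (a *: u + v).
by rewrite !linearP fu fv.
Qed.
HB.instance Definition _ :=
  GRing.isSubmodClosed.Build R cycles boundary_pred boundary_closed.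

Definition homology : lmodType R := quot_mod boundary_pred.
End Homology.

Section Modules.
Variable R : comNzRingType.
Implicit Types M N K : lmodType R.

Definition onto M N (f : M -> N) := forall y, exists x, f x = y.

Definition isomorphic M N := exists f : {linear M -> N}, bijective f.

Definition exact_at M N K (f : {linear M -> N}) (g : {linear N -> K}) :=
  forall y, g y = 0 <-> exists x, f x = y.

Definition short_exact M N K (f : {linear M -> N}) (g : {linear N -> K}) :=
  [/\ injective f, exact_at f g & onto g].

Definition fin_gen M :=
  exists (n : nat) (g : 'I_n -> M),
    forall x, exists c : 'I_n -> R, x = \sum_(i < n) c i *: g i.

Definition projective (P : lmodType R) :=
  forall M N (g : {linear M -> N}) (f : {linear P -> N}), onto g ->
    exists h : {linear P -> M}, forall x, g (h x) = f x.

Record proj_resolution M := ProjResolution {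
  res_obj :> nat -> lmodType R;
  res_diff : forall i, {linear res_obj i.+1 -> res_obj i};
  res_aug : {linear res_obj 0 -> M};
  res_proj : forall i, projective (res_obj i);
  res_surj : onto res_aug;
  res_exact0 : exact_at (res_diff 0) res_aug;
  res_exactS : forall i, exact_at (res_diff i.+1) (res_diff i) }.

Section Ext.
Variables (M : lmodType R) (P : proj_resolution M) (N : lmodType R).

Definition cochain_in (i : nat) :
    {linear hom_mod (P i.-1) N -> hom_mod (P i) N} :=
  match i with
  | 0 => \0
  | k.+1 => precomp (res_diff P k)
  end.

Definition cochain_out (i : nat) :
    {linear hom_mod (P i) N -> hom_mod (P i.+1) N} :=
  precomp (res_diff P i).

(* Ext^i_R(M, N), computed as H^i(Hom_R(P, N)). *)
Definition Ext (i : nat) : lmodType R :=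
  homology (cochain_in i) (cochain_out i).
End Ext.

(* Up to isomorphism, [Ext P N i] does not depend on [P], and every M has a
   projective resolution, so the quantification over P is harmless. *)
Definition annihilates_Ext (a : R) i M N :=
  forall (P : proj_resolution M) (x : Ext P N i), a *: x = 0.

Definition ca (n : nat) : set R :=
  [set a | forall M N, fin_gen M -> fin_gen N ->
     forall i, (n <= i)%N -> annihilates_Ext a i M N].

(* K is a syzygy of M, for some choice of a finitely generated projective
   module mapping onto M. *)
Definition syzygy M K :=
  exists P : lmodType R, [/\ projective P, fin_gen P &
    exists (i : {linear K -> P}) (p : {linear P -> M}), short_exact i p].

Fixpoint nth_syzygy (n : nat) M K : Prop :=
  match n with
  | 0 => isomorphic M K
  | k.+1 => exists L : lmodType R, nth_syzygy k M L /\ syzygy L K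
  end.

Definition Omega_mod (n : nat) K : Prop :=
  exists M, fin_gen M /\ nth_syzygy n M K.

Definition add_closure (G M : lmodType R) : Prop :=
  exists (N : lmodType R) (k : nat),
    isomorphic (M * N)%type {ffun 'I_k -> G}.

(* The class |G|_n. *)
Fixpoint gen_level (G : lmodType R) (n : nat) (M : lmodType R) : Prop :=
  match n with
  | 0 => forall x : M, x = 0
  | 1 => add_closure G M
  | k.+1 => fin_gen M /\
      exists W Y X : lmodType R,
        [/\ fin_gen W, gen_level G k Y, add_closure G X &
          exists (f : {linear Y -> (M * W)%type})
                 (g : {linear (M * W)%type -> X}), short_exact f g]
  end.

Definition is_ideal (I : set R) :=
  [/\ I 0, forall x y, I x -> I y -> I (x + y) & forall a x, I x -> I (a * x)].

Definition noetherian :=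
  forall I : set R, is_ideal I -> exists (n : nat) (g : 'I_n -> R),
    forall x, I x <-> exists c : 'I_n -> R, x = \sum_(i < n) c i * g i.

Definition prime_chain (n : nat) :=
  exists p : 'I_n.+1 -> prime_idealr R, forall i j : 'I_n.+1, (i < j)%N ->
    {subset p i <= p j} /\ exists2 x, x \in p j & x \notin p i.

(* The Krull dimension of R is finite and equal to d. *)
Definition has_krull_dim (d : nat) :=
  prime_chain d /\ forall n, prime_chain n -> (n <= d)%N.
End Modules.

(* Main.v *)
(** Everything takes place among R-modules: for an ideal I, modules over R/I are
    R-modules killed by I, and syzygies over R/I are syzygies there. By
    noetherian induction on I, if dim R/I <= m then the m-th syzygies over R/I
    of finitely generated R/I-modules are generated by one module in a bounded
    number of steps.

    If I is not prime, take x, y outside I with xy in I: every M is an extension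
    of M/xM, killed by I + (x), by xM, killed by I + (y); boundedness of m-th
    syzygies passes from a quotient ring to R/I and through extensions.

    If I = p is prime and dim R/p = k, let a annihilate Ext^{>k} over R/p and let N
    be a k-th syzygy. Since a annihilates Ext^1(N, -), multiplication by a on N
    factors through a projective cover F -> N, which makes N a retract of the kernel of
    F -> N/aN. As a is regular on the modules involved, N/aN is a (k-1)-st
    syzygy over R/(p + (a)), whose dimension is at most k - 1. *)
Require Import Defs.
From HB Require Import structures.
From mathcomp Require Import all_boot all_algebra.
From mathcomp Require Import boolp classical_sets.

Set Implicit Arguments.
Unset Strict Implicit.
Unset Printing Implicit Defensive.

Import GRing.Theory.
Local Open Scope ring_scope.

(** The prime case trades one syzygy for one dimension. The bound s <= dim R/p + 1 is what lets a
    annihilate Ext^1 of a k-th syzygy N, by shifting degrees k times. Read as a (k-1)-st syzygy of a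
    first syzygy, on which a is regular, N leaves after reduction modulo a only a (k-1)-st syzygy
    over R/(p + (a)), and the dimension has dropped to match. For k = 0 no prime contains p + (a),
    so this ideal is R and N/aN = 0. Syzygies are determined only up to projective summands and
    depend on the ring. So the levels are made closed under retracts, and Schanuel's lemma makes the
    choice of a syzygy immaterial. Keeping all modules over R lets the noetherian induction run
    without changing the ring; genuine R/p-modules appear only where the hypothesis on annihilators
    of Ext is used. *)

Section LinearMaps.
Variable R : comNzRingType.
Implicit Types A B C E F K L M N P Q V W X Y Z : lmodType R.

(** * Linear maps, kernels, quotients, pullbacks and retracts *)

Definition lin_of A B (f : A -> B) (fL : linear f) : {linear A -> B} :=
  HB.pack_for {linear A -> B} f (GRing.isLinear.Build R A B *:%R f fL).

Definition lin_fst A B : {linear (A * B)%type -> A} := (@fst A B).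
Definition lin_snd A B : {linear (A * B)%type -> B} := (@snd A B).

Definition copair A B C (f : {linear A -> C}) (g : {linear B -> C}) :
  {linear (A * B)%type -> C} := (f \o lin_fst A B) \+ (g \o lin_snd A B).

Lemma copairE A B C (f : {linear A -> C}) (g : {linear B -> C}) u :
  copair f g u = f u.1 + g u.2.
Proof. by []. Qed.

Fact pairing_linear A B C (f : {linear C -> A}) (g : {linear C -> B}) :
  linear (fun x => (f x, g x)).
Proof. by move=> a x y; rewrite !linearP. Qed.

Definition pairing A B C (f : {linear C -> A}) (g : {linear C -> B}) :
  {linear C -> (A * B)%type} := lin_of (pairing_linear f g).

Lemma pairingE A B C (f : {linear C -> A}) (g : {linear C -> B}) x :
  pairing f g x = (f x, g x).
Proof. by []. Qed.

Lemma scale_linear (a : R) M : linear ( *:%R a : M -> M).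
Proof. by move=> b x y; rewrite scalerDr !scalerA mulrC. Qed.

Definition scale_map (a : R) M : {linear M -> M} := lin_of (@scale_linear a M).

Lemma inj_lin A B (f : {linear A -> B}) :
  (forall x, f x = 0 -> x = 0) -> injective f.
Proof. by move=> f0 x y fxy; apply/subr0_eq/f0; rewrite linearB fxy subrr. Qed.

Lemma exists_ker B C (g : {linear B -> C}) :
  exists (K : lmodType R) (i : {linear K -> B}), injective i /\ exact_at i g.
Proof.
pose i (x : cycles g) : B := cycle_val x.
have iL : linear i by [].
exists (cycles g), (lin_of iL); split=> [|y]; first exact: val_inj.
split=> [/eqP gy|[x <-]]; last exact/eqP/(valP x).
by exists (Cycle (gy : y \in cycle_pred g)).
Qed.

Lemma exists_quot V (S : V -> Prop) :
    S 0 -> (forall a x y, S x -> S y -> S (a *: x + y)) ->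
  exists (Q : lmodType R) (q : {linear V -> Q}), onto q /\ forall v, q v = 0 <-> S v.
Proof.
move=> S0 SP.
pose S' : {pred V} := fun x => `[< S x >].
have S'P : submod_closed S'.
  split=> [|a x y]; first exact/asboolP.
  by move=> /asboolP Sx /asboolP Sy; apply/asboolP; apply: SP.
pose T : submodClosed V :=
  HB.pack_for (submodClosed V) S' (GRing.isSubmodClosed.Build R V S' S'P).
have qL : linear (@quot_proj R V T).
  by move=> a x y; rewrite quot_projD -quot_projZ.
exists (quot_mod T), (lin_of qL); split=> [x|v].
  by have [v ->] := quot_projP x; exists v.
split=> [/eqP|Sv]; first by rewrite /= quot_proj_eq0 => /asboolP.
by apply/eqP; rewrite quot_proj_eq0; apply/asboolP.
Qed.

Lemma factor_onto A B C (q : {linear A -> B}) (f : {linear A -> C}) :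
  onto q -> (forall a, q a = 0 -> f a = 0) ->
  exists h : {linear B -> C}, forall a, h (q a) = f a.
Proof.
move=> q_onto qf; have [s sK] := choice q_onto.
have qfE a b : q a = q b -> f a = f b.
  by move=> qab; apply/subr0_eq; rewrite -linearB qf // linearB qab subrr.
have hL : linear (f \o s).
  by move=> a x y /=; rewrite -linearP; apply: qfE; rewrite linearP !sK.
by exists (lin_of hL) => a; apply: qfE; rewrite sK.
Qed.

Lemma factor_inj A B C (i : {linear A -> B}) (f : {linear C -> B}) :
  injective i -> (forall c, exists a, i a = f c) ->
  exists h : {linear C -> A}, forall c, i (h c) = f c.
Proof.
move=> i_inj if_; have [s sK] := choice if_.
have sL : linear s.
  by move=> a x y; apply: i_inj; rewrite linearP !sK linearP.
by exists (lin_of sL).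
Qed.

Lemma exists_pullback A B C (f : {linear A -> C}) (g : {linear B -> C}) :
  exists (Z : lmodType R) (u : {linear Z -> A}) (v : {linear Z -> B}),
    [/\ forall z, f (u z) = g (v z),
        forall a b, f a = g b -> exists z, u z = a /\ v z = b &
        forall z, u z = 0 -> v z = 0 -> z = 0].
Proof.
have [Z [i [i_inj iE]]] := exists_ker (copair f (\- g : {linear B -> C})).
exists Z, (lin_fst A B \o i : {linear Z -> A}), (lin_snd A B \o i : {linear Z -> B}).
split=> [z|a b fg|z /= u0 v0].
- by apply/subr0_eq/(iE (i z)).2; exists z.
- have [|z iz] := (iE (a, b)).1; first by rewrite copairE /= fg subrr.
  by exists z; rewrite /= iz.
- by apply: i_inj; rewrite linear0; case: (i z) u0 v0 => /= ? ? -> ->.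
Qed.

Definition retract M E :=
  exists (i : {linear M -> E}) (r : {linear E -> M}), forall x, r (i x) = x.

Lemma retract_refl M : retract M M.
Proof. by exists idfun, idfun. Qed.

Lemma retract_trans M E E' : retract M E -> retract E E' -> retract M E'.
Proof.
move=> [i [r ri]] [j [s sj]].
by exists (j \o i : {linear M -> E'}), (r \o s : {linear E' -> M}) => x /=; rewrite sj.
Qed.

Lemma isomorphic_retract M N : isomorphic M N -> retract M N.
Proof.
move=> [f [g fK gK]].
have gL : linear g by apply: can2_linear fK gK.
by exists f, (lin_of gL).
Qed.

Lemma isomorphic_sym M N : isomorphic M N -> isomorphic N M.
Proof.
move=> [f [g fK gK]].
have gL : linear g by apply: can2_linear fK gK.
by exists (lin_of gL), f.
Qed.

Lemma bijective_lin M N (f : {linear M -> N}) :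
  injective f -> onto f -> bijective f.
Proof.
by move=> f_inj /choice [g gK]; exists g => // x; apply: f_inj; rewrite gK.
Qed.

Lemma retract_prodl M N : retract M (M * N)%type.
Proof.
by exists (pairing (idfun : {linear M -> M}) (\0 : {linear M -> N})), (lin_fst M N).
Qed.

Lemma retract_prodr M N : retract N (M * N)%type.
Proof.
by exists (pairing (\0 : {linear N -> M}) (idfun : {linear N -> N})), (lin_snd M N).
Qed.

(** The complement is the kernel of the retraction. It converts retracts into the explicit summands
    that [add_closure] and [gen_level] ask for; being itself a retract of [E], it is finitely
    generated when [E] is. *)
Lemma retract_complement M E : retract M E ->
  exists W : lmodType R, isomorphic (M * W)%type E /\ retract W E.
Proof.
move=> [i [r ri]]; have [W [k [k_inj kE]]] := exists_ker r.
have rk w : r (k w) = 0 by apply/kE; exists w.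
exists W; split.
  exists (copair i k); apply: bijective_lin => [|x].
    apply: inj_lin => -[m w] /eqP; rewrite copairE /= => /eqP mw.
    have m0 : m = 0 by rewrite -[m]ri -[r _]addr0 -(rk w) -linearD mw linear0.
    move: mw; rewrite m0 linear0 add0r => kw0.
    by congr pair; apply: k_inj; rewrite kw0 linear0.
  have [|w kw] := (kE (x - i (r x))).1; first by rewrite linearB ri subrr.
  by exists (r x, w); rewrite copairE /= kw addrC subrK.
have [h hE] : exists h : {linear E -> W},
    forall c, k (h c) = (idfun \- (i \o r) : {linear E -> E}) c.
  apply: factor_inj => // c; apply/kE => /=.
  by rewrite linearB ri subrr.
by exists k, h => w; apply: k_inj; rewrite hE /= rk linear0 subr0.
Qed.

Fact ffun_ev_linear (k : nat) M (i : 'I_k) :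
  linear (fun v : {ffun 'I_k -> M} => v i).
Proof. by move=> a u v; rewrite !ffunE. Qed.

Definition ffun_ev k M i : {linear {ffun 'I_k -> M} -> M} :=
  lin_of (@ffun_ev_linear k M i).

Fact ffun_inc_linear (k : nat) M (i : 'I_k) :
  linear (fun m : M => [ffun j => if j == i then m else 0] : {ffun 'I_k -> M}).
Proof.
move=> a u v; apply/ffunP => j; rewrite !ffunE; case: eqP => // _.
by rewrite scaler0 addr0.
Qed.

Definition ffun_inc k M i : {linear M -> {ffun 'I_k -> M}} :=
  lin_of (@ffun_inc_linear k M i).

Lemma ffun_evE k M i (v : {ffun 'I_k -> M}) : v i = ffun_ev M i v.
Proof. by []. Qed.

Lemma ffun_sum_inc k M (v : {ffun 'I_k -> M}) : v = \sum_i ffun_inc M i (v i).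
Proof.
apply/ffunP => j; rewrite [RHS]ffun_evE linear_sum (bigD1 j) //=.
rewrite ffunE eqxx big1 ?addr0 // => i /negPf ij.
by rewrite ffunE eq_sym ij.
Qed.

Fact ffun_map_linear k M N (f : 'I_k -> {linear M -> N}) :
  linear (fun v : {ffun 'I_k -> M} => [ffun i => f i (v i)] : {ffun 'I_k -> N}).
Proof. by move=> a u v; apply/ffunP => i; rewrite !ffunE linearP. Qed.

Definition ffun_map k M N f : {linear {ffun 'I_k -> M} -> {ffun 'I_k -> N}} :=
  lin_of (@ffun_map_linear k M N f).

Fact ffun_copair_linear k M N (f : 'I_k -> {linear M -> N}) :
  linear (fun v : {ffun 'I_k -> M} => \sum_i f i (v i)).
Proof.
move=> a u v; rewrite scaler_sumr -big_split; apply: eq_bigr => i _.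
by rewrite !ffunE linearP.
Qed.

Definition ffun_copair k M N f : {linear {ffun 'I_k -> M} -> N} :=
  lin_of (@ffun_copair_linear k M N f).

Lemma retract_ffun k M N : retract M N -> retract {ffun 'I_k -> M} {ffun 'I_k -> N}.
Proof.
move=> [i [r ri]]; exists (ffun_map (fun _ => i)), (ffun_map (fun _ => r)) => v.
by apply/ffunP => j; rewrite !ffunE ri.
Qed.
End LinearMaps.

(** * Finitely generated modules and noetherian induction *)

Section FiniteGeneration.
Variable R : comNzRingType.
Implicit Types A B C E F K L M N P Q V W X Y Z : lmodType R.

Lemma fin_gen_family M (T : finType) (g : T -> M) :
  (forall x, exists c : T -> R, x = \sum_t c t *: g t) -> fin_gen M.
Proof.
move=> gP; exists #|T|, (g \o enum_val) => x; have [c ->] := gP x.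
exists (c \o enum_val) => /=.
by rewrite (reindex (@enum_val T xpredT)) //=; apply/onW_bij/enum_val_bij.
Qed.

Lemma fin_gen_onto M N (f : {linear M -> N}) : onto f -> fin_gen M -> fin_gen N.
Proof.
move=> f_onto [n [g gP]]; exists n, (f \o g) => y.
have [x <-] := f_onto y; have [c ->] := gP x; exists c.
by rewrite linear_sum; apply: eq_bigr => i _; rewrite linearZ.
Qed.

Lemma fin_gen_retract M E : retract M E -> fin_gen E -> fin_gen M.
Proof.
by move=> [i [r ri]]; apply: (@fin_gen_onto _ _ r) => x; exists (i x).
Qed.

Lemma fin_gen_ext A B C (f : {linear A -> B}) (g : {linear B -> C}) :
  exact_at f g -> onto g -> fin_gen A -> fin_gen C -> fin_gen B.
Proof.
move=> fg g_onto [n [a aP]] [m [c cP]].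
have [b bc] := choice g_onto.
apply: (@fin_gen_family _ ('I_n + 'I_m)%type
  (fun t => match t with inl i => f (a i) | inr j => b (c j) end)) => x.
have [v vE] := cP (g x).
have [|y fy] := (fg (x - \sum_j v j *: b (c j))).1.
  rewrite linearB vE linear_sum -sumrB big1 // => j _.
  by rewrite linearZ bc subrr.
have [u uE] := aP y.
exists (fun t => match t with inl i => u i | inr j => v j end).
rewrite big_sumType /= -(subrK (\sum_j v j *: b (c j)) x) -fy uE linear_sum.
by congr (_ + _); apply: eq_bigr => i _; rewrite linearZ.
Qed.

Lemma fin_gen_prod M N : fin_gen M -> fin_gen N -> fin_gen (M * N)%type.
Proof.
apply: (@fin_gen_ext _ _ _
  (pairing (idfun : {linear M -> M}) (\0 : {linear M -> N})) (lin_snd M N)).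
- move=> [m n]; split=> [/= ->|[x <-] //]; by exists m.
- by move=> n; exists (0, n).
Qed.

Lemma fin_gen_zero M : (forall x : M, x = 0) -> fin_gen M.
Proof.
by move=> M0; exists 0, (fun _ => 0) => x; exists (fun _ => 0); rewrite big_ord0.
Qed.

Lemma fin_gen_ffun k M : fin_gen M -> fin_gen {ffun 'I_k -> M}.
Proof.
move=> [n [g gP]].
apply: (@fin_gen_family _ ('I_k * 'I_n)%type (fun t => ffun_inc M t.1 (g t.2))) => x.
have /choice [c cP] : forall i, exists c : 'I_n -> R, x i = \sum_j c j *: g j.
  by move=> i; apply: gP.
exists (fun t => c t.1 t.2); rewrite {1}(ffun_sum_inc x).
rewrite -(pair_bigA _ (fun i j => c i j *: ffun_inc M i (g j))).
apply: eq_bigr => i _; rewrite cP linear_sum.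
by apply: eq_bigr => j _; rewrite linearZ.
Qed.

(** Induction on the number of generators: the coefficients of the last generator that occur in
    elements of [S] form an ideal. Finitely many elements of [S] realize its generators, and
    subtracting combinations of them leaves elements of [S] spanned by the first [n] generators. It
    is [S] that [g] has to span, so the induction can drop a generator without changing [M]. *)
Lemma noetherian_submod M (n : nat) (g : 'I_n -> M) (S : M -> Prop) :
    noetherian R -> S 0 -> (forall a x y, S x -> S y -> S (a *: x + y)) ->
    (forall x, S x -> exists c : 'I_n -> R, x = \sum_i c i *: g i) ->
  exists (m : nat) (h : 'I_m -> M), (forall i, S (h i)) /\
    forall x, S x -> exists c : 'I_m -> R, x = \sum_i c i *: h i.
Proof.
move=> noethR; elim: n g S => [|n IHn] g S S0 SP gP.
  exists 0, (fun _ => 0); split=> [[]//|x /gP [c ->]].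
  by exists (fun _ => 0); rewrite !big_ord0.
have SZ a x : S x -> S (a *: x) by move=> Sx; rewrite -[_ *: _]addr0; apply: SP.
have SD x y : S x -> S y -> S (x + y) by rewrite -{2}[x]scale1r; apply: SP.
have Ssum k (c : 'I_k -> R) (h : 'I_k -> M) : (forall i, S (h i)) -> S (\sum_i c i *: h i).
  by move=> Sh; apply: (big_ind S) => // i _; apply: SZ.
pose g' i := g (widen_ord (leqnSn n) i).
pose I : set R :=
  [set a | exists c : 'I_n -> R, S (a *: g ord_max + \sum_i c i *: g' i)]%classic.
have I_ideal : is_ideal I.
  split=> [|x y [c Sc] [d Sd]|a x [c Sc]].
  - by exists (fun _ => 0); rewrite scale0r add0r big1 // => i _; rewrite scale0r.
  - exists (fun i => c i + d i); under eq_bigr do rewrite scalerDl.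
    by rewrite big_split scalerDl /= addrACA; apply: SD.
  - exists (fun i => a * c i); under eq_bigr do rewrite -scalerA.
    by rewrite -scaler_sumr -scalerA -scalerDr; apply: SZ.
have [k [a aP]] := noethR I I_ideal.
have Ia i : I (a i).
  apply/aP; exists (fun j => (j == i)%:R).
  rewrite (bigD1 i) //= eqxx mul1r big1 ?addr0 // => j /negPf ->.
  by rewrite mul0r.
have [d dP] := choice Ia.
pose s i := a i *: g ord_max + \sum_j d i j *: g' j.
have [||x []//|m [h [Sh hP]]] :=
    IHn g' (fun x => S x /\ exists c : 'I_n -> R, x = \sum_i c i *: g' i).
- by split=> //; exists (fun _ => 0); rewrite big1 // => i _; rewrite scale0r.
- move=> b x y [Sx [c xE]] [Sy [e yE]]; split; [exact: SP|rewrite xE yE].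
  exists (fun i => b * c i + e i); under [RHS]eq_bigr do rewrite scalerDl -scalerA.
  by rewrite big_split scaler_sumr.
exists (k + m)%N, (fun i => match split i with inl i => s i | inr j => h j end).
split=> [i|x Sx].
  by case: splitP => j _; [exact: dP | exact: (Sh j).1].
have [c cE] := gP x Sx.
have [|e eE] := (aP (c ord_max)).1.
  exists (fun i => c (widen_ord (leqnSn n) i)).
  by move: Sx; rewrite {1}cE big_ord_recr addrC.
have [|f fE] := hP (x - \sum_i e i *: s i).
  split; first by rewrite addrC -scaleN1r; apply: SP => //; apply: Ssum.
  exists (fun i => c (widen_ord (leqnSn n) i) - \sum_j e j * d j i).
  rewrite {1}cE big_ord_recr /= eE.
  under [in RHS]eq_bigr do rewrite scalerBl scaler_suml.
  rewrite sumrB exchange_big /= -addrA; congr (_ + _).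
  rewrite /s; under [X in _ - X]eq_bigr do rewrite scalerDr.
  rewrite big_split /= opprD addrA scaler_suml.
  under [X in _ - X - _]eq_bigr do rewrite scalerA.
  rewrite subrr add0r; congr (- _); apply: eq_bigr => i _.
  by rewrite scaler_sumr; apply: eq_bigr => j _; rewrite scalerA.
exists (fun i => match split i with inl i => e i | inr j => f j end).
rewrite big_split_ord /= -[x](subrK (\sum_i e i *: s i)) fE addrC.
by congr (_ + _); apply: eq_bigr => i _;
  rewrite ?(unsplitK (inl _ i)) ?(unsplitK (inr _ i)).
Qed.

Lemma fin_gen_sub M N (f : {linear M -> N}) :
  noetherian R -> injective f -> fin_gen N -> fin_gen M.
Proof.
move=> noethR f_inj [n [g gP]].
have [||x _|m [h [/choice [h' h'E] hP]]] :=
    @noetherian_submod N n g (fun y => exists x, f x = y) noethR.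
- by exists 0; rewrite linear0.
- by move=> a _ _ [x <-] [y <-]; exists (a *: x + y); rewrite linearP.
- exact: gP.
exists m, h' => x; have [|c cE] := hP (f x); first by exists x.
exists c; apply: f_inj; rewrite cE linear_sum.
by apply: eq_bigr => i _; rewrite linearZ h'E.
Qed.

(** A failure would yield, by choice, a strictly ascending sequence of ideals; their union is
    finitely generated and so already equals one of them. *)
Lemma noetherian_ind (P : set R -> Prop) : noetherian R ->
  (forall I, is_ideal I -> (forall J, is_ideal J -> (I `<` J)%classic -> P J) -> P I) ->
  forall I, is_ideal I -> P I.
Proof.
move=> noethR IH I0 I0_ideal; apply: contrapT => nPI0.
pose T := {I : set R | is_ideal I /\ ~ P I}.
have /choice [next nextP] : forall t : T, exists t' : T, (sval t `<` sval t')%classic.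
  move=> [I [I_ideal nPI]]; apply: contrapT => no_next; apply: (nPI).
  apply: IH => // J J_ideal IJ; apply: contrapT => nPJ.
  by apply: no_next; exists (exist _ J (conj J_ideal nPJ)).
pose t k := iter k next (exist _ I0 (conj I0_ideal nPI0) : T).
pose I k := sval (t k).
have I_ideal k : is_ideal (I k) by case: (svalP (t k)).
have I_mono k l x : (k <= l)%N -> I k x -> I l x.
  move=> /subnK <-; elim: (l - k)%N => [//|m IHm] /IHm.
  by rewrite addSn; apply: (nextP (t (m + k)%N)).1.
pose U : set R := [set x | exists k, I k x]%classic.
have [|n [g gP]] := noethR U.
  split=> [|x y [k Ix] [l Iy]|a x [k Ix]].
  - by exists 0%N; case: (I_ideal 0%N).
  - exists (maxn k l); have [_ ID _] := I_ideal (maxn k l).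
    by apply: ID; [apply: (I_mono k) | apply: (I_mono l)]; rewrite ?leq_maxl ?leq_maxr.
  - by exists k; have [_ _] := I_ideal k; apply.
have /choice [k kP] : forall i, U (g i).
  move=> i; apply/gP; exists (fun j => (j == i)%:R).
  rewrite (bigD1 i) //= eqxx mul1r big1 ?addr0 // => j /negPf ->.
  by rewrite mul0r.
pose m := (\max_i k i)%N.
have [_ /(_ (_ : I m.+1 `<=` I m)%classic) []] := nextP (t m).
move=> x Ix; have [|c ->] := (gP x).1; first by exists m.+1.
have [Im0 ImD ImM] := I_ideal m.
apply: (big_ind (I m)) => // i _; apply: ImM.
by apply: I_mono (kP i); apply: leq_bigmax.
Qed.
End FiniteGeneration.

(** * Modules over R/I as R-modules killed by I *)

Section KilledModules.
Variable R : comNzRingType.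
Implicit Types A B C E F K L M N P Q V W X Y Z : lmodType R.
Implicit Types I J : set R.

Definition killed I M := forall a (x : M), I a -> a *: x = 0.

(* The category mod R/I. *)
Definition md I M := killed I M /\ fin_gen M.

Lemma killed_inj I M N (f : {linear M -> N}) : injective f -> killed I N -> killed I M.
Proof. by move=> f_inj IN a x Ia; apply: f_inj; rewrite linearZZ linear0 IN. Qed.

Lemma killed_onto I M N (f : {linear M -> N}) : onto f -> killed I M -> killed I N.
Proof.
by move=> f_onto IM a y Ia; have [x <-] := f_onto y; rewrite -linearZZ IM ?linear0.
Qed.

Lemma killed_prod I M N : killed I M -> killed I N -> killed I (M * N)%type.
Proof. by move=> IM IN a [x y] Ia; congr pair; [exact: IM|exact: IN]. Qed.

Lemma killed_ffun I k M : killed I M -> killed I {ffun 'I_k -> M}.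
Proof. by move=> IM a x Ia; apply/ffunP => i; rewrite !ffunE IM. Qed.

Lemma killed_sub I J M : (I `<=` J)%classic -> killed J M -> killed I M.
Proof. by move=> IJ JM a x /IJ; apply: JM. Qed.

Lemma killed_retract I M E : retract M E -> killed I E -> killed I M.
Proof.
by move=> [i [r ri]]; apply: (@killed_onto _ _ _ r) => x; exists (i x).
Qed.

Lemma md_sub I J M : (I `<=` J)%classic -> md J M -> md I M.
Proof. by move=> IJ [JM fM]; split=> //; apply: killed_sub JM. Qed.

Lemma md_retract I M E : retract M E -> md I E -> md I M.
Proof.
move=> ME [IE fE]; split; first exact: killed_retract IE.
exact: fin_gen_retract fE.
Qed.

Lemma md_onto I M N (f : {linear M -> N}) : onto f -> md I M -> md I N.
Proof.
by move=> f_onto [IM fM]; split; [exact: killed_onto f_onto IM|exact: fin_gen_onto f_onto fM].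
Qed.

Lemma md_inj I M N (f : {linear M -> N}) :
  noetherian R -> injective f -> md I N -> md I M.
Proof.
move=> noethR f_inj [IN fN].
by split; [exact: killed_inj f_inj IN|exact: fin_gen_sub f_inj fN].
Qed.

Lemma md_prod I M N : md I M -> md I N -> md I (M * N)%type.
Proof.
by move=> [IM fM] [IN fN]; split; [apply: killed_prod|apply: fin_gen_prod].
Qed.

Lemma md_ffun I k M : md I M -> md I {ffun 'I_k -> M}.
Proof.
by move=> [IM fM]; split; [apply: killed_ffun|apply: fin_gen_ffun].
Qed.

Lemma md_zero I M : (forall x : M, x = 0) -> md I M.
Proof. by move=> M0; split=> [a x _|]; [exact: M0|exact: fin_gen_zero]. Qed.

(** Lifting is required against all modules killed by [I], finitely generated or not: over R/I this
    is genuine projectivity, as the resolutions that define Ext demand. *)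
Definition rproj I P :=
  forall M N (g : {linear M -> N}) (f : {linear P -> N}),
    killed I M -> killed I N -> onto g ->
    exists h : {linear P -> M}, forall x, g (h x) = f x.

Lemma rproj_prod I P Q : rproj I P -> rproj I Q -> rproj I (P * Q)%type.
Proof.
move=> Pp Qp M N g f IM IN g_onto.
have [h hE] := Pp M N g (f \o pairing idfun \0 : {linear P -> N}) IM IN g_onto.
have [k kE] := Qp M N g (f \o pairing \0 idfun : {linear Q -> N}) IM IN g_onto.
exists (copair h k) => -[x y]; rewrite copairE linearD hE kE /= -linearD.
by congr (f _); congr pair; rewrite /= ?addr0 ?add0r.
Qed.

(* The projectives of mod R/I. *)
Definition pj I P := md I P /\ rproj I P.

Lemma pj_prod I P Q : pj I P -> pj I Q -> pj I (P * Q)%type.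
Proof. by move=> [? ?] [? ?]; split; [apply: md_prod|apply: rproj_prod]. Qed.

(** The pair is R/I with the class of 1; powers of [A] are the free modules over R/I. *)
Definition cyclic_base I A (e : A) :=
  (forall a, exists x, a = x *: e) /\ forall x, x *: e = 0 <-> I x.

Lemma exists_cyclic_base I : is_ideal I -> exists (A : lmodType R) (e : A), cyclic_base I e.
Proof.
move=> [I0 ID IM].
have [|A [q [q_onto qE]]] := @exists_quot R R^o I I0.
  by move=> a x y Ix Iy; apply: ID => //; apply: IM.
exists A, (q 1); split=> [a|x].
  by have [x <-] := q_onto a; exists x; rewrite -linearZ /= [_ *: _]mulr1.
by rewrite -linearZ /= [_ *: _]mulr1.
Qed.

Section CyclicBase.
Variables (I : set R) (A : lmodType R) (e : A).
Hypothesis Ae : cyclic_base I e.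

Lemma cyclic_base_md : is_ideal I -> md I A.
Proof.
move=> [I0 ID IM]; split=> [a x Ia|].
  have [y ->] := Ae.1 x; rewrite scalerA mulrC; apply/Ae.2; exact: IM.
exists 1%N, (fun _ => e) => x; have [y ->] := Ae.1 x.
by exists (fun _ => y); rewrite big_ord1.
Qed.

Lemma cyclic_base_map M (m : M) : killed I M ->
  exists f : {linear A -> M}, f e = m.
Proof.
move=> IM.
have L1 : linear (fun x : R^o => x *: e) by move=> a x y; rewrite scalerDl scalerA.
have L2 : linear (fun x : R^o => x *: m) by move=> a x y; rewrite scalerDl scalerA.
have [||h hE] := @factor_onto _ _ _ _ (lin_of L1) (lin_of L2).
- by move=> a; have [x ->] := Ae.1 a; exists x.
- by move=> x /= /(Ae.2 x).1 Ix; rewrite IM.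
by exists h; have := hE 1; rewrite /= !scale1r.
Qed.

Lemma free_map M k (m : 'I_k -> M) : killed I M ->
  exists f : {linear {ffun 'I_k -> A} -> M}, forall i, f (ffun_inc A i e) = m i.
Proof.
move=> IM; have /choice [f fE] := fun i => cyclic_base_map (m i) IM.
exists (ffun_copair f) => i; rewrite /= (bigD1 i) //= big1 ?addr0 => [|j /negPf ij].
  by rewrite ffunE eqxx fE.
by rewrite ffunE ij linear0.
Qed.

Lemma free_eq M k (f g : {linear {ffun 'I_k -> A} -> M}) :
  (forall i, f (ffun_inc A i e) = g (ffun_inc A i e)) -> f =1 g.
Proof.
move=> fg v; rewrite (ffun_sum_inc v) !linear_sum; apply: eq_bigr => i _.
by have [x ->] := Ae.1 (v i); rewrite !linearZ fg.
Qed.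

Lemma free_rproj k : rproj I {ffun 'I_k -> A}.
Proof.
move=> M N g f IM IN g_onto.
have /choice [m mE] := fun i => g_onto (f (ffun_inc A i e)).
have [h hE] := free_map m IM; exists h.
by apply: (@free_eq _ _ (g \o h : {linear _ -> N})) => i /=; rewrite hE mE.
Qed.

Lemma free_pj k : is_ideal I -> pj I {ffun 'I_k -> A}.
Proof.
by move=> II; split; [apply/md_ffun/cyclic_base_md|exact: free_rproj].
Qed.

Lemma free_cover M : md I M ->
  exists k (f : {linear {ffun 'I_k -> A} -> M}), onto f.
Proof.
move=> [IM [k [g gP]]]; have [f fE] := free_map g IM.
exists k, f => x; have [c ->] := gP x.
exists (\sum_i c i *: ffun_inc A i e).
by rewrite linear_sum; apply: eq_bigr => i _; rewrite linearZ fE.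
Qed.

Lemma pj_free P : pj I P -> exists k, retract P {ffun 'I_k -> A}.
Proof.
move=> [Pm Pp]; have [k [f f_onto]] := free_cover Pm.
exists k; have [|h hE] := Pp _ _ f idfun _ Pm.1 f_onto; last by exists h, f.
apply: killed_ffun => a x Ia; have [y ->] := Ae.1 x.
by rewrite scalerA mulrC -scalerA (Ae.2 a).2 // scaler0.
Qed.
End CyclicBase.

Lemma exists_pj_cover I M : is_ideal I -> md I M ->
  exists (P : lmodType R) (f : {linear P -> M}), pj I P /\ onto f.
Proof.
move=> II Mm; have [A [e Ae]] := exists_cyclic_base II.
have [k [f f_onto]] := free_cover Ae Mm.
by exists {ffun 'I_k -> A}, f; split=> //; apply: free_pj Ae _ II.
Qed.
End KilledModules.

(** * Short exact sequences: pullbacks, Schanuel, horseshoe *)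

Section ExactSequences.
Variable R : comNzRingType.
Implicit Types A B C E F K L M N P Q V W X Y Z : lmodType R.
Implicit Types I J : set R.

Lemma short_exact_comp0 A M B (f : {linear A -> M}) (g : {linear M -> B}) a :
  short_exact f g -> g (f a) = 0.
Proof. by move=> [_ fg _]; apply/fg; exists a. Qed.

Lemma bij_retract M N (f : {linear M -> N}) :
  injective f -> onto f -> retract M N /\ retract N M.
Proof.
move=> f_inj f_onto; have MN : isomorphic M N by exists f; apply: bijective_lin.
by split; apply: isomorphic_retract => //; apply: isomorphic_sym.
Qed.

Lemma pullback_lift A B C Z (u : {linear Z -> A}) (v : {linear Z -> B})
    (f : {linear A -> C}) (g : {linear B -> C}) X
    (c : {linear X -> A}) (d : {linear X -> B}) :
  (forall a b, f a = g b -> exists z, u z = a /\ v z = b) ->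
  (forall z, u z = 0 -> v z = 0 -> z = 0) ->
  (forall x, f (c x) = g (d x)) ->
  exists h : {linear X -> Z}, forall x, u (h x) = c x /\ v (h x) = d x.
Proof.
move=> Z_ex Z_inj cd.
have [||h hE] := @factor_inj _ _ _ _ (pairing u v) (pairing c d).
- by apply: inj_lin => z [/Z_inj].
- by move=> x; have [z [uz vz]] := Z_ex _ _ (cd x); exists z; rewrite !pairingE uz vz.
by exists h => x; have [] := hE x.
Qed.

Lemma ses_pullback A M B E (f : {linear A -> M}) (g : {linear M -> B})
    (phi : {linear E -> B}) : short_exact f g ->
  exists (Z : lmodType R) (f' : {linear A -> Z}) (v : {linear Z -> E}) (u : {linear Z -> M}),
    [/\ short_exact f' v, forall z, g (u z) = phi (v z),
        forall m e, g m = phi e -> exists z, u z = m /\ v z = e &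
        forall z, u z = 0 -> v z = 0 -> z = 0].
Proof.
move=> fg; have [f_inj fgE g_onto] := fg.
have [Z [u [v [uv Z_ex Z_inj]]]] := exists_pullback g phi.
have [|f' f'E] := pullback_lift (c := f) (d := \0) Z_ex Z_inj.
  by move=> a /=; rewrite linear0 (short_exact_comp0 _ fg).
exists Z, f', v, u; split=> //; split.
- by apply: inj_lin => a f'a; apply: f_inj; rewrite -(f'E a).1 f'a !linear0.
- move=> z; split=> [vz|[a <-]]; last by rewrite (f'E a).2.
  have [|a fa] := (fgE (u z)).1; first by rewrite uv vz linear0.
  exists a; apply/subr0_eq/Z_inj; rewrite linearB.
    by rewrite (f'E a).1 fa subrr.
  by rewrite (f'E a).2 vz subrr.
- move=> e; have [m mE] := g_onto (phi e).
  by have [z [_ <-]] := Z_ex _ _ mE; exists z.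
Qed.

(** Over a common quotient [B], each projection of the pullback inherits the kernel of the opposite
    sequence. This compares two covers of one module. *)
Lemma ses_pullback2 A M B (A' : lmodType R) E (f : {linear A -> M}) (g : {linear M -> B})
    (f' : {linear A' -> E}) (g' : {linear E -> B}) :
    short_exact f g -> short_exact f' g' ->
  exists (Z : lmodType R) (i : {linear A -> Z}) (v : {linear Z -> E})
    (j : {linear A' -> Z}) (u : {linear Z -> M}),
    [/\ short_exact i v, short_exact j u & forall z, u z = 0 -> v z = 0 -> z = 0].
Proof.
move=> fg fg'; have [Z [i [v [u [iv uv Z_ex Z_inj]]]]] := ses_pullback g' fg.
have [f'_inj f'g' g'_onto] := fg'.
have [|j jE] := pullback_lift (c := \0) (d := f') Z_ex Z_inj.
  by move=> a /=; rewrite linear0 (short_exact_comp0 _ fg').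
exists Z, i, v, j, u; split=> //; split.
- by apply: inj_lin => a ja; apply: f'_inj; rewrite -(jE a).2 ja !linear0.
- move=> z; split=> [uz|[a <-]]; last by rewrite (jE a).1.
  have [|a fa] := (f'g' (v z)).1; first by rewrite -uv uz linear0.
  exists a; apply/subr0_eq/Z_inj; rewrite linearB.
    by rewrite (jE a).1 uz subrr.
  by rewrite (jE a).2 fa subrr.
- move=> m; have [e eE] := g'_onto (g m).
  by have [z [<- _]] := Z_ex _ _ (esym eE); exists z.
Qed.

(* Half of Schanuel's lemma, for retracts. *)
Lemma schanuel_retract I M E K P L Q (k : {linear K -> P}) (p : {linear P -> M})
    (l : {linear L -> Q}) (q : {linear Q -> E}) :
  pj I P -> pj I Q -> killed I M -> killed I E -> retract M E ->
  short_exact k p -> short_exact l q -> retract K (L * P)%type.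
Proof.
move=> [Pm Pp] [Qm Qp] IM IE [i [r ri]] kp lq.
have [k_inj kpE p_onto] := kp; have [l_inj lqE q_onto] := lq.
have [i' i'E] := Pp _ _ q (i \o p : {linear P -> E}) Qm.1 IE q_onto.
have [r' r'E] := Qp _ _ p (r \o q : {linear Q -> M}) Pm.1 IM p_onto.
(* [r' \o i'] lifts [r \o i], the identity, so it differs from the identity by a map [t] into [K];
   the identity of [K] is then [b \o a] plus [t \o k]. *)
have [|t tE] := factor_inj (f := idfun \- (r' \o i') : {linear P -> P}) k_inj.
  by move=> c; apply/kpE; rewrite /= linearB r'E /= i'E /= ri subrr.
have [|a aE] := factor_inj (f := i' \o k : {linear K -> Q}) l_inj.
  by move=> c; apply/lqE; rewrite /= i'E /= (short_exact_comp0 _ kp) linear0.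
have [|b bE] := factor_inj (f := r' \o l : {linear L -> P}) k_inj.
  by move=> c; apply/kpE; rewrite /= r'E /= (short_exact_comp0 _ lq) linear0.
exists (pairing a k), (copair b t) => x.
apply: k_inj; rewrite copairE /= linearD bE tE /= aE /=.
by rewrite addrC subrK.
Qed.

Lemma horseshoe I A M B (LA QA LB QB : lmodType R) (f : {linear A -> M}) (g : {linear M -> B})
    (iA : {linear LA -> QA}) (qA : {linear QA -> A})
    (iB : {linear LB -> QB}) (qB : {linear QB -> B}) :
  short_exact f g -> short_exact iA qA -> short_exact iB qB ->
  rproj I QB -> killed I M -> killed I B ->
  exists (L : lmodType R) (k : {linear L -> (QA * QB)%type}) (p : {linear (QA * QB)%type -> M})
    (a : {linear LA -> L}) (b : {linear L -> LB}),
    short_exact k p /\ short_exact a b.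
Proof.
move=> fg qA_ses qB_ses QBp IM IB.
have [f_inj fgE g_onto] := fg; have [iA_inj iqA qA_onto] := qA_ses.
have [iB_inj iqB qB_onto] := qB_ses.
have [s sE] := QBp _ _ g qB IM IB g_onto.
pose p := copair (f \o qA : {linear QA -> M}) s.
have [L [k [k_inj kE]]] := exists_ker p.
have gp y : g (p y) = qB y.2.
  by rewrite /p copairE linearD /= (short_exact_comp0 _ fg) add0r sE.
have pk l : p (k l) = 0 by apply/kE; exists l.
have [|b bE] := factor_inj (f := lin_snd QA QB \o k : {linear L -> QB}) iB_inj.
  by move=> l; apply/iqB; rewrite /= -gp pk linear0.
have [|a aE] := factor_inj (f := pairing iA (\0 : {linear LA -> QB})) k_inj.
  move=> l; apply/kE; rewrite /p copairE /= linear0 addr0.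
  by rewrite (short_exact_comp0 _ qA_ses) linear0.
exists L, k, p, a, b; split; split=> //.
- move=> m; have [y yE] := qB_onto (g m).
  have [|x xE] := (fgE (m - s y)).1; first by rewrite linearB sE yE subrr.
  have [z zE] := qA_onto x; exists (z, y).
  by rewrite /p copairE /= zE xE subrK.
- apply: inj_lin => x ax; apply: iA_inj.
  by have := aE x; rewrite ax !linear0 pairingE => -[].
- move=> l; split=> [bl|[x <-]].
    have kl2 : (k l).2 = 0 by have := bE l; rewrite bl linear0 /= => <-.
    have [|x xE] := (iqA (k l).1).1.
      apply: f_inj; have := pk l; rewrite /p copairE /= kl2 !linear0 addr0.
      by move=> ->.
    by exists x; apply: k_inj; rewrite aE pairingE xE /= -kl2 -surjective_pairing.
  by apply: iB_inj; rewrite bE /= aE linear0.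
- move=> y; have [|x xE] := (fgE (s (iB y))).1.
    by rewrite sE (short_exact_comp0 _ qB_ses).
  have [z zE] := qA_onto x.
  have [|l lE] := (kE (- z, iB y)).1.
    by rewrite /p copairE /= !linearN zE xE addNr.
  by exists l; apply: iB_inj; rewrite bE /= lE.
Qed.

(** The pullback of [v] and [p] maps onto [Z] with kernel [W], and splits as [L * Q] since [Q] is
    projective. The submodule [L] of [Z] thus becomes, up to a projective summand, an extension of
    [Z] by a syzygy of Z/L. *)
Lemma ses_rotate I L Z F W Q (f : {linear L -> Z}) (v : {linear Z -> F})
    (i : {linear W -> Q}) (p : {linear Q -> F}) :
  short_exact f v -> short_exact i p -> rproj I Q -> killed I Z -> killed I F ->
  exists (a : {linear W -> (L * Q)%type}) (b : {linear (L * Q)%type -> Z}),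
    short_exact a b.
Proof.
move=> fv ip Qp IZ IF; have [f_inj fvE v_onto] := fv; have [i_inj ipE p_onto] := ip.
have [s sE] := Qp _ _ v p IZ IF v_onto.
have [|t tE] := factor_inj (f := s \o i : {linear W -> Z}) f_inj.
  by move=> w; apply/fvE; rewrite /= sE (short_exact_comp0 _ ip).
exists (pairing (\- t : {linear W -> L}) i), (copair f s); split.
- apply: inj_lin => w; rewrite pairingE => -[_ iw].
  by apply: i_inj; rewrite iw linear0.
- move=> [l q]; rewrite copairE /=; split=> [lq|[w [<- <-]]]; last first.
    by rewrite linearN tE /= addNr.
  have [|w wE] := (ipE q).1.
    by rewrite -sE -(linear0 v) -lq linearD (short_exact_comp0 _ fv) add0r.
  exists w; rewrite /= wE; congr pair; apply: f_inj.
  by rewrite linearN tE /= wE; apply/eqP; rewrite eq_sym -addr_eq0 lq.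
- move=> z; have [q qE] := p_onto (v z).
  have [|l lE] := (fvE (z - s q)).1; first by rewrite linearB sE qE subrr.
  by exists (l, q); rewrite copairE /= lE subrK.
Qed.

Lemma ses_prodl A M B P (f : {linear A -> M}) (g : {linear M -> B}) :
  short_exact f g ->
  exists (f' : {linear (A * P)%type -> (M * P)%type}) (g' : {linear (M * P)%type -> B}),
    short_exact f' g'.
Proof.
move=> fg; have [f_inj fgE g_onto] := fg.
exists (pairing (f \o lin_fst A P) (lin_snd A P)), (g \o lin_fst M P); split.
- apply: inj_lin => -[a p]; rewrite pairingE /= => -[fa ->].
  by congr pair; apply: f_inj; rewrite fa linear0.
- move=> [m p] /=; split=> [/fgE [a <-]|[[a p'] [<- _]]]; last first.
    exact: short_exact_comp0.
  by exists (a, p).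
- by move=> b; have [m <-] := g_onto b; exists (m, 0).
Qed.

Lemma ses_ffun k A M B (f : {linear A -> M}) (g : {linear M -> B}) :
  short_exact f g ->
  short_exact (ffun_map (fun _ : 'I_k => f)) (ffun_map (fun _ : 'I_k => g)).
Proof.
move=> fg; have [f_inj fgE g_onto] := fg; split.
- move=> x y /ffunP xy; apply/ffunP => i.
  by have := xy i; rewrite !ffunE => /f_inj.
- move=> x; split=> [gx|[y <-]]; last first.
    by apply/ffunP => i; rewrite !ffunE (short_exact_comp0 _ fg).
  have /choice [y yE] : forall i, exists a, f a = x i.
    by move=> i; apply/fgE; move/ffunP: gx => /(_ i); rewrite !ffunE.
  by exists [ffun i => y i]; apply/ffunP => i; rewrite !ffunE yE.
- move=> y; have /choice [x xE] := fun i => g_onto (y i).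
  by exists [ffun i => x i]; apply/ffunP => i; rewrite !ffunE xE.
Qed.

Lemma rproj_ffun I k P : rproj I P -> rproj I {ffun 'I_k -> P}.
Proof.
move=> Pp M N g f IM IN g_onto.
have /choice [h hE] : forall i, exists h : {linear P -> M},
    forall x, g (h x) = f (ffun_inc P i x).
  by move=> i; exact: (Pp M N g (f \o ffun_inc P i : {linear P -> N})).
exists (ffun_copair h) => x; rewrite /= linear_sum {2}(ffun_sum_inc x) linear_sum.
by apply: eq_bigr => i _; rewrite hE.
Qed.
End ExactSequences.

(** * Generation in boundedly many steps, and its behaviour under syzygies *)

Section Generation.
Variable R : comNzRingType.
Implicit Types A B E F G K L M N P Q V W X Y Z : lmodType R.
Implicit Types I J : set R.
Implicit Types C D : lmodType R -> Prop.

Definition subclass C D := forall M, C M -> D M.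

Definition retracts C M := exists2 E, C E & retract M E.

(** [killed I M] is imposed because an extension of modules killed by [I] may fail to be killed by
    [I]. *)
Definition extensions I C D M := killed I M /\
  exists A B (f : {linear A -> M}) (g : {linear M -> B}),
    [/\ short_exact f g, C A & D B].

Definition add G X := exists k, retract X {ffun 'I_k -> G}.

(* Unlike in [gen_level], all modules that occur are killed by I, so that
   syzygies over R/I can be taken throughout. *)
Fixpoint level I G (n : nat) : lmodType R -> Prop :=
  match n with
  | 0 => fun M => forall x : M, x = 0
  | k.+1 => retracts (extensions I (level I G k) (add G))
  end.

Definition bounded I C := exists G n, md I G /\ subclass C (level I G n).

Definition syz I M K := exists P (i : {linear K -> P}) (p : {linear P -> M}),
  pj I P /\ short_exact i p.

Definition Om I C K := exists M, C M /\ syz I M K.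

(** [C] is arbitrary so that an induction on [j] can replace it by [Om I C]; closure properties then
    have to be checked for first syzygies only. *)
Definition bounded_syz I j C := bounded I (iter j (Om I) C).

Lemma retracts_self C : subclass C (retracts C).
Proof. by move=> M CM; exists M => //; apply: retract_refl. Qed.

Lemma extensions_md I C D : subclass C (md I) -> subclass D (md I) ->
  subclass (extensions I C D) (md I).
Proof.
move=> CI DI M [IM [A [B [f [g [[_ fg g_onto] CA DB]]]]]]; split=> //.
by apply: (fin_gen_ext fg g_onto); [case: (CI A)|case: (DI B)].
Qed.

Lemma retracts_md I C : subclass C (md I) -> subclass (retracts C) (md I).
Proof. by move=> CI M [E /CI Em ME]; apply: md_retract Em. Qed.

Lemma add_md I G : md I G -> subclass (add G) (md I).
Proof. by move=> Gm M [k] /md_retract; apply; apply: md_ffun. Qed.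

Lemma level_md I G n : md I G -> subclass (level I G n) (md I).
Proof.
move=> Gm; elim: n => [|n IHn] M; first exact: md_zero.
by apply/retracts_md/extensions_md => //; apply: add_md.
Qed.

Lemma level_retract I G n M E : retract M E -> level I G n E -> level I G n M.
Proof.
case: n => [|n] ME; last by move=> [E' E'l EE']; exists E' => //; apply: retract_trans EE'.
by have [i [r ri]] := ME; move=> E0 x; rewrite -[x]ri [i x]E0 linear0.
Qed.

(** Induction on the length of [B]. If [B] is a retract of [E], an extension of [X] by [Y], then [M]
    is a retract of the pullback [Z] of [M] along E -> B. The preimage [W] of [Y] in [Z] is an
    extension of [Y] by [A], to which the induction applies, and Z/W is [X]. *)
Lemma level_ext I G a b A M B (f : {linear A -> M}) (g : {linear M -> B}) :
  killed I M -> short_exact f g -> level I G a A -> level I G b B ->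
  level I G (b + a) M.
Proof.
move=> + + Al; elim: b M B f g => [|b IHb] M B f g IM fg Bl.
  apply: (level_retract _ Al); have [f_inj fgE _] := fg.
  by apply: (bij_retract f_inj _).2 => y; apply/fgE/Bl.
have [E [IE [Y [X [y [z [yz Yl Xa]]]]]] [i [r ri]]] := Bl.
have [Z [f' [v [u [f'v uv Z_ex Z_inj]]]]] := ses_pullback r fg.
have [y_inj yzE z_onto] := yz; have [_ _ v_onto] := f'v.
have IZ : killed I Z.
  apply: (@killed_inj _ _ _ _ (pairing u v)); last exact: killed_prod.
  by apply: inj_lin => t [/Z_inj].
have [W [fW [vW [uW [fvW uvW W_ex W_inj]]]]] := ses_pullback y f'v.
have uW_inj : injective uW.
  apply: inj_lin => w uw; apply: W_inj => //.
  by apply: y_inj; rewrite -uvW uw !linear0.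
exists Z; last first.
  have [|h hE] := @pullback_lift _ _ _ _ _ _ _ _ _ M idfun (i \o g) Z_ex Z_inj.
    by move=> x /=; rewrite ri.
  by exists h, u => x; rewrite (hE x).1.
split=> //; exists W, X, uW, (z \o v : {linear Z -> X}); split=> //.
  split=> // [t|x]; last first.
    by have [e <-] := z_onto x; have [t <-] := v_onto e; exists t.
  split=> [/= /yzE [s sE]|[w <-]]; last by rewrite /= uvW (short_exact_comp0 _ yz).
  by have [w [<- _]] := W_ex t s (esym sE); exists w.
by apply: IHb fvW Yl; apply: killed_inj uW_inj IZ.
Qed.

Lemma level_base I G G' n : retract G G' -> subclass (level I G n) (level I G' n).
Proof.
move=> GG'; elim: n => [//|n IHn] M [E [IE [A [B [f [g [fg Al [k Ba]]]]]]] ME].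
exists E => //; split=> //; exists A, B, f, g; split=> //; first exact: IHn.
by exists k; apply: retract_trans Ba (retract_ffun k GG').
Qed.

Lemma level_sub I J G n : (I `<=` J)%classic -> subclass (level J G n) (level I G n).
Proof.
move=> IJ; elim: n => [//|n IHn] M [E [IE [A [B [f [g [fg Al Ba]]]]]] ME].
exists E => //; split; first exact: killed_sub IE.
by exists A, B, f, g; split=> //; apply: IHn.
Qed.

Lemma zero_ses X : short_exact (\0 : {linear {ffun 'I_0 -> X} -> X}) (idfun : {linear X -> X}).
Proof.
split=> [|y|y]; last by exists y.
  by move=> x y _; apply/ffunP => -[].
by split=> [/= ->|[_ <-]]//; exists 0.
Qed.

Lemma add_level1 I G : md I G -> subclass (add G) (level I G 1).
Proof.
move=> Gm X Xa; apply: retracts_self; split; first by case: (add_md Gm Xa).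
do 4 eexists; split; [exact: zero_ses| |exact: Xa].
by move=> x; apply/ffunP => -[].
Qed.

Lemma retract_add_closure G X : add G X -> add_closure G X.
Proof.
by move=> [k /retract_complement [W [WE _]]]; exists W, k.
Qed.

(** The hierarchies start differently: level 1 is [add_closure] in [gen_level], but retracts of
    extensions by a zero module in [level]. Above it, the complement of [M] in [E] serves as the
    summand [W]. *)
Lemma level_gen_level I G n M : md I G -> level I G n M -> gen_level G n M.
Proof.
move=> Gm; elim: n M => [//|[_|n IHn]] M Ml; have Mm := level_md Gm Ml; last first.
  have {Ml} [E Ee ME] := Ml.
  have Em : md I E.
    apply: extensions_md Ee; [exact: (@level_md _ _ n.+1)|exact: add_md].
  have [IE [Y [X [f [g [fg Yl Xa]]]]]] := Ee.
  have [f_inj fgE g_onto] := fg.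
  have [W [MWE WE]] := retract_complement ME.
  have [h [h' hK h'K]] := MWE.
  have h'L : linear h' by apply: can2_linear hK h'K.
  split; first by case: Mm.
  exists W, Y, X; split; first by case: (md_retract WE Em).
  - exact: IHn.
  - exact: retract_add_closure.
  exists (lin_of h'L \o f : {linear Y -> (M * W)%type}), (g \o h : {linear (M * W)%type -> X}).
  split=> [x y /= /(can_inj h'K) /f_inj //|y|x].
    split=> [/= /fgE [x xE]|[x <-]]; first by exists x; rewrite /= xE hK.
    by rewrite /= h'K; apply/fgE; exists x.
  by have [y <-] := g_onto x; exists (h' y); rewrite /= h'K.
(* Level 1: [Y] is zero, so [g] is an isomorphism and [M] a retract of a power of [G]. *)
have [E [_ [Y [X [f [g [[_ fgE g_onto] Y0 [k Xa]]]]]]] ME] := Ml.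
apply: retract_add_closure; exists k; apply: retract_trans ME _.
apply: retract_trans Xa; have g_inj : injective g.
  by apply: inj_lin => x /fgE [y <-]; rewrite [y]Y0 linear0.
by case: (bij_retract g_inj g_onto).
Qed.

Lemma bounded_subclass I C D : subclass C D -> bounded I D -> bounded I C.
Proof.
by move=> CD [G [n [Gm Dl]]]; exists G, n; split=> // M /CD; apply: Dl.
Qed.

Lemma bounded_retracts I C : bounded I C -> bounded I (retracts C).
Proof.
move=> [G [n [Gm Cl]]]; exists G, n; split=> // M [E /Cl El ME].
exact: level_retract El.
Qed.

Lemma bounded_extensions I C D :
  bounded I C -> bounded I D -> bounded I (extensions I C D).
Proof.
move=> [G [n [Gm Cl]]] [G' [n' [Gm' Dl]]].
exists (G * G')%type, (n' + n)%N; split; first exact: md_prod.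
move=> M [IM [A [B [f [g [fg /Cl Al /Dl Bl]]]]]].
apply: level_ext IM fg _ _.
  by apply: level_base Al; apply: retract_prodl.
by apply: level_base Bl; apply: retract_prodr.
Qed.

Lemma bounded_add I G : md I G -> bounded I (add G).
Proof. by move=> Gm; exists G, 1%N; split=> //; apply: add_level1. Qed.

Lemma bounded_sub I J C : (I `<=` J)%classic -> bounded J C -> bounded I C.
Proof.
move=> IJ [G [n [Gm Cl]]]; exists G, n; split; first exact: md_sub Gm.
by move=> M /Cl; apply: level_sub.
Qed.

Lemma Om_subclass I C D : subclass C D -> subclass (Om I C) (Om I D).
Proof. by move=> CD K [M [/CD DM MK]]; exists M. Qed.

Lemma iter_Om_subclass I j C D :
  subclass C D -> subclass (iter j (Om I) C) (iter j (Om I) D).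
Proof. by move=> CD; elim: j => //= j; apply: Om_subclass. Qed.

Lemma bounded_syz_subclass I j C D :
  subclass C D -> bounded_syz I j D -> bounded_syz I j C.
Proof. by move=> CD; apply/bounded_subclass/iter_Om_subclass. Qed.

Lemma bounded_syzS I j C : bounded_syz I j.+1 C = bounded_syz I j (Om I C).
Proof. by rewrite /bounded_syz iterSr. Qed.

Lemma syz_prod I M K P : pj I P -> syz I M K -> syz I M (K * P)%type.
Proof.
move=> Pp [Q [i [q [Qp iq]]]]; have [f [g fg]] := ses_prodl P iq.
by exists (Q * P)%type, f, g; split=> //; apply: pj_prod.
Qed.

Section Noetherian.
Hypothesis noethR : noetherian R.

Lemma syz_md I M K : syz I M K -> md I K.
Proof. by move=> [P [i [p [[Pm _] [i_inj _ _]]]]]; apply: md_inj i_inj Pm. Qed.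

Lemma Om_md I C : subclass (Om I C) (md I).
Proof. by move=> K [M [_ /syz_md]]. Qed.

Variable I : set R.
Hypothesis I_ideal : is_ideal I.

Lemma exists_syz M : md I M -> exists K, syz I M K.
Proof.
move=> Mm; have [P [p [Pp p_onto]]] := exists_pj_cover I_ideal Mm.
have [K [i [i_inj ip]]] := exists_ker p.
by exists K, P, i, p.
Qed.

(** By Schanuel, a syzygy of a retract of [E] is a retract of [L * P] for any syzygy [L] of [E], and
    [L * P] is again a syzygy of [E]. So the inclusion in retracts persists for first syzygies, and
    induction on [j] applies. *)
Lemma bounded_syz_retracts j C D : subclass D (md I) -> subclass C (retracts D) ->
  bounded_syz I j D -> bounded_syz I j C.
Proof.
elim: j C D => [|j IHj] C D Dm CD.
  by move=> /bounded_retracts; apply: bounded_subclass.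
rewrite !bounded_syzS; apply: IHj; first exact: Om_md.
move=> K [M [/CD [E DE ME] [P [k [p [Pp kp]]]]]].
have [L EL] := exists_syz (Dm _ DE).
exists (L * P)%type; first by exists E; split=> //; apply: syz_prod.
have [Q [l [q [Qp lq]]]] := EL.
apply: (schanuel_retract Pp Qp _ _ ME kp lq); last by case: (Dm _ DE).
by case: (md_retract ME (Dm _ DE)).
Qed.

(** The horseshoe lemma gives one syzygy [N] of [M] that is an extension of a syzygy of [B] by one
    of [A]. Any other is a retract of [N * P], and [P] is absorbed into the syzygy of [A]. *)
Lemma bounded_syz_extensions j C D : subclass C (md I) -> subclass D (md I) ->
  bounded_syz I j C -> bounded_syz I j D -> bounded_syz I j (extensions I C D).
Proof.
elim: j C D => [|j IHj] C D Cm Dm; first exact: bounded_extensions.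
rewrite !bounded_syzS => Cb Db.
apply: (@bounded_syz_retracts _ _ (extensions I (Om I C) (Om I D))).
- by apply: extensions_md; apply: Om_md.
- move=> K [M [[IM [A [B [f [g [fg CA DB]]]]]] [P [k [p [Pp kp]]]]]].
  have [L AL] := exists_syz (Cm _ CA); have [Q [l [q [Qp lq]]]] := AL.
  have [L' BL'] := exists_syz (Dm _ DB); have [Q' [l' [q' [Qp' lq']]]] := BL'.
  have [N [n [t [a [b [nt ab]]]]]] := horseshoe fg lq lq' Qp'.2 IM (Dm _ DB).1.
  exists (N * P)%type; last first.
    by apply: (schanuel_retract Pp (pj_prod Qp Qp') IM IM (retract_refl M) kp nt).
  split.
    apply: killed_prod; last exact: Pp.1.1.
    by apply: (@killed_inj _ _ _ _ n); [case: nt|case: (pj_prod Qp Qp') => -[]].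
  have [a' [b' ab']] := ses_prodl P ab.
  exists (L * P)%type, L', a', b'; split=> //; last by exists B.
  by exists A; split=> //; apply: syz_prod.
by apply: IHj => //; apply: Om_md.
Qed.

Lemma bounded_pj : bounded I (pj I).
Proof.
have [A [e Ae]] := exists_cyclic_base I_ideal.
apply: (@bounded_subclass _ _ (add A)); last exact/bounded_add/(cyclic_base_md Ae I_ideal).
by move=> P Pp; exact: (pj_free Ae Pp).
Qed.

(** Up to retracts and a projective summand, a syzygy of a power of [G] is the same power of one
    fixed syzygy [L] of [G]; so [L] and R/I generate them all. *)
Lemma bounded_Om_add G : md I G -> bounded I (Om I (add G)).
Proof.
(* Index 1 makes [bounded_syz] a statement on first syzygies; retracts of powers are thereby
   replaced by the powers themselves. *)
move=> Gm; apply: (@bounded_syz_retracts 1 _ (fun M => exists k, M = {ffun 'I_k -> G})).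
- by move=> _ [k ->]; apply: md_ffun.
- by move=> M [k Mk]; exists {ffun 'I_k -> G} => //; exists k.
have [L GL] := exists_syz Gm; have [Q [l [q [Qp lq]]]] := GL.
apply: (@bounded_subclass _ _ (retracts (extensions I (add L) (pj I)))); last first.
  apply/bounded_retracts/bounded_extensions; last exact: bounded_pj.
  exact/bounded_add/(syz_md GL).
move=> K [_ [[k ->] [P [i [p [Pp ip]]]]]].
have Qk : pj I {ffun 'I_k -> Q}.
  by split; [apply: md_ffun; case: Qp|apply: rproj_ffun; case: Qp].
have Gk := md_ffun k Gm.
exists ({ffun 'I_k -> L} * P)%type; last first.
  exact: (schanuel_retract Pp Qk Gk.1 Gk.1 (retract_refl _) ip (ses_ffun k lq)).
have Lk := md_ffun k (syz_md GL).
split; first by apply: killed_prod; [case: Lk|case: Pp => -[]].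
exists {ffun 'I_k -> L}, P, (pairing idfun \0), (lin_snd _ _); split=> //; last first.
  by exists k; apply: retract_refl.
split.
- by apply: inj_lin => x; rewrite pairingE => -[].
- move=> [x y]; split=> [/= ->|[z <-]//]; by exists x.
- by move=> y; exists (0, y).
Qed.

(** Levels are built from [add G] by extensions and retracts, with which first syzygies are
    compatible; syzygies of zero modules are projective. Hence a bound at some syzygy index persists
    at all higher ones. *)
Lemma bounded_Om C : bounded I C -> bounded I (Om I C).
Proof.
move=> [G [n [Gm Cl]]]; apply: (@bounded_subclass _ _ (Om I (level I G n))).
  exact: Om_subclass.
elim: n {C Cl} => [|n IHn].
  apply: bounded_subclass (bounded_retracts bounded_pj) => K.
  move=> [M [M0 [P [i [p [Pp [i_inj ip _]]]]]]]; exists P => //.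
  by apply: (bij_retract i_inj _).1 => x; apply/ip/M0.
apply: (@bounded_syz_retracts 1 _ (extensions I (level I G n) (add G))) => //.
  by apply: extensions_md; [apply: level_md|apply: add_md].
apply: bounded_syz_extensions => //; [exact: level_md|exact: add_md|].
exact: bounded_Om_add.
Qed.

Lemma bounded_syz_le j k C : (j <= k)%N -> bounded_syz I j C -> bounded_syz I k C.
Proof.
move=> /subnK <-; elim: (k - j)%N => [//|n IHn] Cb.
by rewrite addSn; apply/bounded_Om/IHn.
Qed.
End Noetherian.

(* Comparing covers F over R/J and Q over R/I of M, with kernels K and L: in the
   pullback Z of F and Q, L is the kernel of Z -> F and K that of Z -> Q. So Z is
   bounded by K, and L by Z and the syzygies of F. *)
Lemma bounded_syz_base_change I J j C : noetherian R -> is_ideal I -> is_ideal J ->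
  (I `<=` J)%classic -> subclass C (md J) ->
  bounded I (iter j (Om J) C) -> bounded_syz I j C.
Proof.
move=> noethR I_ideal J_ideal IJ; elim: j C => [//|j IHj] C Cm.
rewrite iterSr => /IHj Cb; rewrite bounded_syzS.
have {Cb} Cb : bounded_syz I j (Om J C) by apply: Cb; apply: Om_md.
have JI : subclass (md J) (md I) by move=> M; apply: md_sub.
have pjJ : subclass (pj J) (md I) by move=> P [/JI].
apply: (@bounded_syz_retracts noethR _ I_ideal _ _ (extensions I (Om I (pj J))
    (extensions I (Om J C) (pj I)))).
- apply: extensions_md; first exact: Om_md.
  by apply: extensions_md => [K /Om_md - /(_ noethR) /JI|P []].
- move=> L [M [CM [Q [l [q [Qp lq]]]]]].
  have [F [p [Fp p_onto]]] := exists_pj_cover J_ideal (Cm _ CM).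
  have [K [k [k_inj kp]]] := exists_ker p.
  have kp_ses : short_exact k p by [].
  have [Z [i [v [i' [u [iv iu Z_inj]]]]]] := ses_pullback2 lq kp_ses.
  have IZ : killed I Z.
    apply: (@killed_inj _ _ _ _ (pairing u v)).
      by apply: inj_lin => z [/Z_inj].
    by apply: killed_prod; [case: Qp => -[]|case: (pjJ _ Fp)].
  have [W FW] := exists_syz I_ideal (pjJ _ Fp).
  have [Q' [w [q' [Qp' wq']]]] := FW.
  have [a [b ab]] := ses_rotate iv wq' Qp'.2 IZ (pjJ _ Fp).1.
  exists (L * Q')%type; last exact: retract_prodl.
  split.
    apply: killed_prod; last by case: Qp' => -[].
    by apply: (@killed_inj _ _ _ _ l); [case: lq|case: Qp => -[]].
  exists W, Z, a, b; split=> //; first by exists F.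
  split=> //; exists K, Q, i', u; split=> //.
  by exists M; split=> //; exists F, k, p.
have Kb : bounded_syz I j (extensions I (Om J C) (pj I)).
  apply: bounded_syz_extensions => //.
  - by move=> K /Om_md - /(_ noethR) /JI.
  - by move=> P [].
  - by apply: (@bounded_syz_le noethR _ I_ideal 0) => //; apply: bounded_pj.
apply: bounded_syz_extensions => //; first exact: Om_md.
  by apply: extensions_md => [K /Om_md - /(_ noethR) /JI|P []].
(* The projectives over R/J are bounded at index 0, hence so are all their syzygies over R/I. *)
rewrite -bounded_syzS; apply: (@bounded_syz_le noethR _ I_ideal 0) => //.
exact: (bounded_sub IJ (bounded_pj J_ideal)).
Qed.
End Generation.

(** * Reduction modulo an element *)

Section Cokernels.
Variable R : comNzRingType.
Implicit Types A B E F G K L M N P Q V W X Y Z : lmodType R.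
Implicit Types I J : set R.
Implicit Types C D : lmodType R -> Prop.

Definition add_elt I (a : R) : set R :=
  [set x | exists y r, I y /\ x = y + r * a]%classic.

Lemma add_elt_ideal I a : is_ideal I -> is_ideal (add_elt I a).
Proof.
move=> [I0 ID IM]; split=> [|_ _ [y [r [Iy ->]]] [z [s [Iz ->]]]|b _ [y [r [Iy ->]]]].
- by exists 0, 0; split=> //; rewrite mul0r addr0.
- by exists (y + z), (r + s); split; [exact: ID|rewrite mulrDl addrACA].
- by exists (b * y), (b * r); split; [exact: IM|rewrite mulrDr mulrA].
Qed.

Lemma sub_add_elt I a : (I `<=` add_elt I a)%classic.
Proof. by move=> x Ix; exists x, 0; rewrite mul0r addr0. Qed.

Lemma mem_add_elt I a : is_ideal I -> add_elt I a a.
Proof. by move=> [I0 _ _]; exists 0, 1; rewrite mul1r add0r. Qed.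

Lemma proper_add_elt I a : is_ideal I -> ~ I a -> (I `<` add_elt I a)%classic.
Proof.
move=> II nIa; split; first exact: sub_add_elt.
by move=> /(_ a (mem_add_elt a II)).
Qed.

Lemma killed_add_elt I a M : killed I M -> (forall x : M, a *: x = 0) ->
  killed (add_elt I a) M.
Proof.
move=> IM aM _ x [y [r [Iy ->]]].
by rewrite scalerDl IM // -scalerA aM scaler0 addr0.
Qed.

Definition coker_scale (a : R) M N (q : {linear M -> N}) :=
  onto q /\ forall x, q x = 0 <-> exists y, x = a *: y.

Definition Coker a C N := exists M (q : {linear M -> N}), C M /\ coker_scale a q.

Lemma exists_coker_scale a M : exists (N : lmodType R) (q : {linear M -> N}), coker_scale a q.
Proof.
apply: exists_quot => [|b _ _ [x ->] [y ->]]; first by exists 0; rewrite scaler0.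
by exists (b *: x + y); rewrite scalerDr !scalerA mulrC.
Qed.

Lemma coker_scale0 a M N (q : {linear M -> N}) : coker_scale a q ->
  forall x : N, a *: x = 0.
Proof.
move=> [q_onto qE] x; have [y <-] := q_onto x.
by rewrite -linearZZ; apply/qE; exists y.
Qed.

Lemma coker_scale_md I a M N (q : {linear M -> N}) : coker_scale a q ->
  md I M -> md (add_elt I a) N.
Proof.
move=> qN /(md_onto qN.1) [IN fN]; split=> //.
exact: killed_add_elt IN (coker_scale0 qN).
Qed.

Lemma coker_scale_pj I a P Q (q : {linear P -> Q}) : is_ideal I ->
  coker_scale a q -> pj I P -> pj (add_elt I a) Q.
Proof.
move=> II qQ [Pm Pp]; split; first exact: (coker_scale_md qQ Pm).
move=> M N g f JM JN g_onto; have sIJ := @sub_add_elt I a.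
have [h hE] := Pp M N g (f \o q) (killed_sub sIJ JM) (killed_sub sIJ JN) g_onto.
have [|h' h'E] := factor_onto (f := h) qQ.1.
  by move=> _ /qQ.2 [y ->]; rewrite linearZZ JM //; apply: mem_add_elt.
by exists h' => x; have [y <-] := qQ.1 x; rewrite h'E hE.
Qed.

(** M = aM is allowed, and it does occur when the dimension is 0. *)
Definition regular_on (a : R) M := forall x : M, a *: x = 0 -> x = 0.

Lemma regular_on_inj a M N (f : {linear M -> N}) :
  injective f -> regular_on a N -> regular_on a M.
Proof.
move=> f_inj aN x ax; apply: f_inj; rewrite linear0; apply: aN.
by rewrite -linearZZ ax linear0.
Qed.

Lemma regular_on_pj I a P : is_ideal I -> (forall x, I (a * x) -> I x) ->
  pj I P -> regular_on a P.
Proof.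
move=> II aI Pp; have [A [e Ae]] := exists_cyclic_base II.
have [k [i [r ri]]] := pj_free Ae Pp.
apply: (@regular_on_inj _ _ _ i); first exact: can_inj ri.
move=> x ax; apply/ffunP => j; rewrite ffunE.
have [y yE] := Ae.1 (x j); move/ffunP/(_ j): ax.
by rewrite !ffunE yE scalerA => /(Ae.2 _).1 /aI Iy; apply/Ae.2.
Qed.

(** If [i k = a *: y] then [a *: p y = 0], so [p y = 0] by regularity and [y] comes from [K]:
    reduction modulo [a] stays exact on the left. Exactness elsewhere is automatic. *)
Lemma coker_scale_syz I a M K (M' K' : lmodType R)
    (q : {linear M -> M'}) (q' : {linear K -> K'}) :
  is_ideal I -> regular_on a M -> coker_scale a q -> coker_scale a q' ->
  syz I M K -> syz (add_elt I a) M' K'.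
Proof.
move=> II aM qM qK [P [i [p [Pp ip]]]]; have [i_inj ipE p_onto] := ip.
have [P' [qP qPE]] := exists_coker_scale a P.
have [|i' i'E] := factor_onto (f := qP \o i : {linear K -> P'}) qK.1.
  by move=> _ /qK.2 [y ->] /=; rewrite linearZZ; apply/qPE.2; exists (i y).
have [|p' p'E] := factor_onto (f := q \o p : {linear P -> M'}) qPE.1.
  by move=> _ /qPE.2 [y ->] /=; rewrite linearZZ; apply/qM.2; exists (p y).
exists P', i', p'; split; first exact: coker_scale_pj qPE Pp.
split.
- apply: inj_lin => x; have [k <-] := qK.1 x.
  rewrite i'E /= => /qPE.2 [y yE]; apply/qK.2.
  have [|z zE] := (ipE y).1; last by exists z; apply: i_inj; rewrite linearZZ zE.
  by apply: aM; rewrite -linearZZ -yE (short_exact_comp0 _ ip).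
- move=> x; split=> [|[y <-]]; last first.
    have [k <-] := qK.1 y.
    by rewrite i'E /= p'E /= (short_exact_comp0 _ ip) linear0.
  have [y <-] := qPE.1 x; rewrite p'E /= => /qM.2 [m mE].
  have [z zE] := p_onto m.
  have [|k kE] := (ipE (y - a *: z)).1; first by rewrite linearB linearZZ zE mE subrr.
  exists (q' k); rewrite i'E /= kE linearB -[RHS]subr0; congr (_ - _).
  by apply/qPE.2; exists z.
- move=> x; have [m <-] := qM.1 x; have [y <-] := p_onto m.
  by exists (qP y); rewrite p'E.
Qed.

(** Every syzygy embeds in a projective, where [a] is regular, so the reduction can be repeated;
    regularity is assumed only for the modules at the start. *)
Lemma coker_scale_iter_syz I a j C : is_ideal I -> (forall x, I (a * x) -> I x) ->
  (forall M, C M -> regular_on a M) ->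
  subclass (Coker a (iter j (Om I) C)) (iter j (Om (add_elt I a)) (Coker a C)).
Proof.
move=> II aI aC; elim: j => [//|j IHj] K' [K [q' [[M [Mj MK]] qK]]].
have [M' [q qM]] := exists_coker_scale a M.
exists M'; split; first by apply: IHj; exists M, q.
apply: coker_scale_syz qM qK MK => //.
case: {IHj} j Mj => [/aC //|j [L [_ [P [i [p [Pp [i_inj _ _]]]]]]]].
exact: regular_on_inj i_inj (regular_on_pj II aI Pp).
Qed.

(** The kernel [E] of F -> N/aN is the preimage of aN under [p]; it contains the image of [h].
    Dividing [p] on [E] by [a], which regularity permits, gives [r] with
    [a *: r (h x) = p (h x) = a *: x]. *)
Lemma retract_syz_coker I a N (N' : lmodType R) F (p : {linear F -> N}) (h : {linear N -> F})
    (q : {linear N -> N'}) :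
  pj I F -> onto p -> (forall x : N, p (h x) = a *: x) -> regular_on a N ->
  coker_scale a q -> retracts (Om I (eq N')) N.
Proof.
move=> Fp p_onto hE aN qN.
have [E [e [e_inj eE]]] := exists_ker (q \o p : {linear F -> N'}).
exists E.
  exists N'; split=> //; exists F, e, (q \o p); split=> //; split=> // x.
  have [y <-] := qN.1 x; have [z <-] := p_onto y; by exists z.
have [|i iE] := factor_inj (f := h) e_inj.
  by move=> x; apply/eE; rewrite /= hE; apply/qN.2; exists x.
have a_inj : injective (scale_map a N) by apply: inj_lin => x; apply: aN.
have [|r rE] := factor_inj (f := p \o e : {linear E -> N}) a_inj.
  move=> x; have /qN.2 [y yE] : q (p (e x)) = 0 by apply/(eE (e x)).2; exists x.
  by exists y; rewrite /= yE.
by exists i, r => x; apply: a_inj; rewrite rE /= iE hE.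
Qed.
End Cokernels.

(** * Splicing resolutions and annihilators of Ext *)

Section Resolutions.
Variable R : comNzRingType.
Implicit Types K M N P : lmodType R.

Section Cons.
Variables (M K P : lmodType R) (i : {linear K -> P}) (p : {linear P -> M}).
Hypotheses (Pp : projective P) (ip : short_exact i p).
Variable res : proj_resolution K.

Definition cons_obj (n : nat) : lmodType R := if n is k.+1 then res k else P.

Definition cons_diff n : {linear cons_obj n.+1 -> cons_obj n} :=
  match n with
  | 0 => i \o res_aug res
  | k.+1 => res_diff res k
  end.

Fact cons_proj n : projective (cons_obj n).
Proof. by case: n => [|n] //=; apply: res_proj. Qed.

Fact cons_exact0 : exact_at (cons_diff 0) p.
Proof.
have [_ ipE _] := ip => y; rewrite ipE.
split=> [[x <-]|[x <-]]; last by exists (res_aug res x).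
by have [z <-] := res_surj res x; exists z.
Qed.

Fact cons_exactS n : exact_at (cons_diff n.+1) (cons_diff n).
Proof.
case: n => [|n]; last exact: res_exactS.
move=> y; rewrite -(@res_exact0 _ _ res y) /=; have [i_inj _ _] := ip.
by split=> [iy|->]; [apply: i_inj; rewrite iy|]; rewrite linear0.
Qed.

Fact cons_surj : onto p.
Proof. by case: ip. Qed.

Definition cons_resolution : proj_resolution M :=
  @ProjResolution R M cons_obj cons_diff p cons_proj cons_surj cons_exact0 cons_exactS.
End Cons.

(** Splicing P -> M onto a resolution of [K] shifts degrees by one, and the two Ext modules agree by
    conversion. The degree on [K] must be positive: in degree 0 its complex has a zero incoming map,
    unlike the spliced one in degree 1. *)
Lemma annihilates_Ext_shift (a : R) n M K P (i : {linear K -> P}) (p : {linear P -> M}) N :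
  projective P -> short_exact i p ->
  annihilates_Ext a n.+2 M N -> annihilates_Ext a n.+1 K N.
Proof. by move=> Pp ip aM res; apply: (aM (cons_resolution Pp ip res)). Qed.

Lemma annihilated_cocycle (a : R) M (P : proj_resolution M) N n (u : hom_mod (P n) N) :
  (forall x : Ext P N n, a *: x = 0) -> cochain_out P N n u = 0 ->
  exists t, cochain_in P N n t = a *: u.
Proof.
move=> aE /eqP u_cycle.
pose z : cycles (cochain_out P N n) := Cycle (u_cycle : u \in cycle_pred _).
have := aE (quot_proj _ z : Ext P N n).
rewrite [_ *: _]quot_projZ => /eqP; rewrite quot_proj_eq0 => /asboolP [t tE].
by exists t.
Qed.

(** The augmentation onto [K] is a 1-cocycle of the spliced resolution, representing the extension
    class of P -> M. That [a] times it is a coboundary gives [t : P -> K] equal to [a] on [K]; then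
    [a - i \o t] vanishes on [K] and descends to [M]. *)
Lemma annihilates_Ext1_factor (a : R) M K P (i : {linear K -> P}) (p : {linear P -> M}) :
  projective P -> short_exact i p -> inhabited (proj_resolution K) ->
  annihilates_Ext a 1 M K ->
  exists h : {linear M -> P}, forall x, p (h x) = a *: x.
Proof.
move=> Pp ip [res] aM; pose rs := cons_resolution Pp ip res.
have [t tE] : exists t : {linear P -> K}, forall k, t (i k) = a *: k.
  have [|t tE] := @annihilated_cocycle a M rs K 1 (res_aug res) (aM rs).
    by apply: hom_modP => y /=; apply/(@res_exact0 _ _ res); exists y.
  exists t => k; have [y <-] := @res_surj _ _ res k.
  exact: (congr1 (fun f : hom_mod (rs 1) K => hom_fun f y) tE).
have [_ ipE p_onto] := ip.
have [|h hE] := factor_onto (f := scale_map a P \- (i \o t) : {linear P -> P}) p_onto.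
  by move=> y /ipE [k <-] /=; rewrite tE linearZZ subrr.
exists h => x; have [y <-] := p_onto x; rewrite hE /= linearB linearZZ.
by rewrite (short_exact_comp0 _ ip) subr0.
Qed.
End Resolutions.

(** * Existence of projective resolutions over a noetherian ring *)

Section FreeResolution.
Variable R : comNzRingType.
Hypothesis noethR : noetherian R.

Definition zero_ideal : set R := [set x | x = 0]%classic.

Lemma zero_ideal_ideal : is_ideal zero_ideal.
Proof.
by split=> [//|x y -> ->|a x ->]; rewrite /zero_ideal /= ?addr0 ?mulr0.
Qed.

Lemma killed_zero_ideal (M : lmodType R) : killed zero_ideal M.
Proof. by move=> a x ->; rewrite scale0r. Qed.

Lemma rproj_zero_ideal (P : lmodType R) : rproj zero_ideal P <-> projective P.
Proof.
split=> Pp M N g f; last by move=> _ _; apply: Pp.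
by apply: Pp; apply: killed_zero_ideal.
Qed.

(** Bundling the finiteness proof lets the choice of a presentation be iterated on kernels. *)
Record fg_module := FgModule { fg_mod :> lmodType R; fg_modP : fin_gen fg_mod }.

Record presentation (M : lmodType R) := Presentation {
  pres_ker : fg_module;
  pres_obj : lmodType R;
  pres_inc : {linear pres_ker -> pres_obj};
  pres_map : {linear pres_obj -> M};
  pres_proj : projective pres_obj;
  pres_ses : short_exact pres_inc pres_map }.

Lemma exists_presentation (M : fg_module) : exists _ : presentation M, True.
Proof.
have [P [p [[Pm Pp] p_onto]]] :=
  exists_pj_cover zero_ideal_ideal (conj (@killed_zero_ideal M) (fg_modP M)).
have [K [i [i_inj ip]]] := exists_ker p.
have fK : fin_gen K by apply: fin_gen_sub i_inj Pm.2.
have ses : short_exact (i : {linear FgModule fK -> P}) p by [].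
by exists (Presentation ((rproj_zero_ideal P).1 Pp) ses).
Qed.

Lemma exists_resolution (M : lmodType R) : fin_gen M -> inhabited (proj_resolution M).
Proof.
move=> fM; pose pres (N : fg_module) : presentation N := projT1 (cid (exists_presentation N)).
pose K := fix K n : fg_module := if n is k.+1 then pres_ker (pres (K k)) else FgModule fM.
pose P n := pres_obj (pres (K n)).
pose p n : {linear P n -> K n} := pres_map (pres (K n)).
pose i n : {linear K n.+1 -> P n} := pres_inc (pres (K n)).
have ip n : short_exact (i n) (p n) := pres_ses (pres (K n)).
have p_onto n : onto (p n) by case: (ip n).
have exi n : exact_at (i n \o p n.+1) (p n).
  move=> y; have [_ -> _] := ip n; split=> [[x <-]|[x <-]]; last by exists (p n.+1 x).
  by have [z <-] := p_onto n.+1 x; exists z.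
constructor; apply: (@ProjResolution R M P (fun n => i n \o p n.+1) (p 0%N)) => [n||//|n].
- exact: pres_proj.
- exact: p_onto.
- move=> y; rewrite -[X in _ <-> X](exi n.+1) /=; have [i_inj _ _] := ip n.
  by split=> [iy|->]; [apply: i_inj; rewrite iy|]; rewrite linear0.
Qed.
End FreeResolution.

(** * Passage between R-modules killed by p and R/p-modules *)

Section PrimeQuotient.
Local Open Scope quotient_scope.
Variables (R : comNzRingType) (p : prime_idealr R).
Implicit Types F K M N P : lmodType R.

Local Notation Q := {ideal_quot p}.
Local Notation pi := (\pi_Q : R -> Q).

Definition ideal_of : set R := [set x | x \in p]%classic.
Local Notation I := ideal_of.

Lemma ideal_of_ideal : is_ideal I.
Proof.
split=> [|x y xp yp|a x xp]; rewrite /I /=; [exact: rpred0|exact: rpredD|exact: idealMr].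
Qed.

Lemma pi_eq (x y : R) : pi x = pi y <-> x - y \in p.
Proof. by rewrite Quotient.idealrBE; split=> [/eqP|/eqP]. Qed.

Lemma pi_repr (c : Q) : pi (repr c) = c.
Proof. exact: reprK. Qed.

Lemma piD (x y : R) : pi (x + y) = pi x + pi y.
Proof. by rewrite piE. Qed.

Lemma piM (x y : R) : pi (x * y) = pi x * pi y.
Proof. by rewrite piE. Qed.

Lemma pi1 : pi 1 = 1.
Proof. by rewrite piE. Qed.

Lemma pi0 : pi 0 = 0.
Proof. by rewrite piE. Qed.

Lemma pi_eq0 (x : R) : pi x = 0 <-> x \in p.
Proof. by rewrite -pi0 pi_eq subr0. Qed.

Lemma noetherian_quot : noetherian R -> noetherian Q.
Proof.
move=> noethR J [J0 JD JM].
have [|n [g gP]] := noethR [set x | J (pi x)]%classic.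
  split=> [|x y /= Jx Jy|a x /= Jx]; rewrite /= ?pi0 ?piD ?piM //.
    exact: JD.
  exact: JM.
have Jsum (c : 'I_n -> R) : pi (\sum_i c i * g i) = \sum_i pi (c i) * pi (g i).
  by rewrite (big_morph pi piD pi0); apply: eq_bigr => i _; rewrite piM.
exists n, (fun i => pi (g i)) => x; split=> [|[c ->]].
  rewrite -(pi_repr x) => /(gP (repr x)).1 [c ->].
  by exists (fun i => pi (c i)).
have /(gP _).2 : exists c', \sum_i repr (c i) * g i = \sum_i c' i * g i by eexists.
rewrite /= Jsum; congr J; apply: eq_bigr => i _; congr (_ * _); exact: pi_repr.
Qed.

Section Descent.
Variables (M : lmodType R) (IM : killed I M).

(** A copy of [M] indexed by the proof that [p] kills it, so that the R/p-module structure, which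
    depends on this proof, can be attached to the type. *)
Definition quo_mod of killed I M : Type := M.
Local Notation qM := (quo_mod IM).

HB.instance Definition _ := GRing.Zmodule.on qM.

Definition quo_scale (c : Q) (x : qM) : qM := (repr c *: (x : M)).

Lemma quo_scale_pi (x : R) (m : qM) : quo_scale (pi x) m = x *: (m : M).
Proof.
apply/subr0_eq; rewrite /quo_scale -scalerBl; apply: IM.
by rewrite /I /= -pi_eq pi_repr.
Qed.

Fact quo_scaleA a b (m : qM) : quo_scale a (quo_scale b m) = quo_scale (a * b) m.
Proof.
by rewrite -(pi_repr a) -(pi_repr b) -piM !quo_scale_pi scalerA.
Qed.

Fact quo_scale1 : left_id 1 quo_scale.
Proof. by move=> m; rewrite -pi1 quo_scale_pi scale1r. Qed.

Fact quo_scaleDr : right_distributive quo_scale +%R.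
Proof. by move=> a x y; rewrite /quo_scale scalerDr. Qed.

Fact quo_scaleDl m : {morph quo_scale^~ m : a b / a + b}.
Proof.
by move=> a b /=; rewrite -(pi_repr a) -(pi_repr b) -piD !quo_scale_pi scalerDl.
Qed.

HB.instance Definition _ := GRing.Zmodule_isLmodule.Build Q qM
  quo_scaleA quo_scale1 quo_scaleDr quo_scaleDl.
End Descent.

Lemma quo_scaleE M (IM : killed I M) x (m : M) : x *: m = pi x *: (m : quo_mod IM).
Proof. by have := quo_scale_pi (x : R) (m : quo_mod IM) => /esym. Qed.

Lemma quo_linear M N (IM : killed I M) (IN : killed I N) (f : {linear M -> N}) :
  linear (f : quo_mod IM -> quo_mod IN).
Proof.
move=> c x y; rewrite -(pi_repr c) -!quo_scaleE; exact: linearP.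
Qed.

Definition quo_lin M N (IM : killed I M) (IN : killed I N) (f : {linear M -> N}) :
  {linear quo_mod IM -> quo_mod IN} := lin_of (@quo_linear M N IM IN f).

Lemma unquo_linear M N (IM : killed I M) (IN : killed I N)
  (f : {linear quo_mod IM -> quo_mod IN}) : linear (f : M -> N).
Proof.
move=> c x y; rewrite (quo_scaleE IM) (quo_scaleE IN); exact: linearP.
Qed.

Lemma quo_fin_gen M (IM : killed I M) : fin_gen M -> fin_gen (quo_mod IM).
Proof.
move=> [n [g gP]]; exists n, g => x; have [c ->] := gP x.
by exists (fun i => pi (c i)); apply: eq_bigr => i _; rewrite -quo_scaleE.
Qed.

Section Restriction.
Variable M : lmodType Q.

Definition restr_mod : Type := M.
HB.instance Definition _ := GRing.Zmodule.on restr_mod.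

Definition restr_scale (a : R) (x : restr_mod) : restr_mod := pi a *: (x : M).

Fact restr_scaleA a b m : restr_scale a (restr_scale b m) = restr_scale (a * b) m.
Proof. by rewrite /restr_scale scalerA piM. Qed.

Fact restr_scale1 : left_id 1 restr_scale.
Proof. by move=> m; rewrite /restr_scale pi1 scale1r. Qed.

Fact restr_scaleDr : right_distributive restr_scale +%R.
Proof. by move=> a x y; rewrite /restr_scale scalerDr. Qed.

Fact restr_scaleDl m : {morph restr_scale^~ m : a b / a + b}.
Proof. by move=> a b; rewrite /restr_scale piD scalerDl. Qed.

HB.instance Definition _ := GRing.Zmodule_isLmodule.Build R restr_mod
  restr_scaleA restr_scale1 restr_scaleDr restr_scaleDl.

Lemma killed_restr_mod : killed I restr_mod.
Proof. by move=> a m /pi_eq0 pa; rewrite -[LHS]/(pi a *: (m : M)) pa scale0r. Qed.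
End Restriction.

Lemma quo_projective P (IP : killed I P) : rproj I P -> projective (quo_mod IP).
Proof.
move=> Pp M N g f g_onto.
have gL : linear (g : restr_mod M -> restr_mod N).
  by move=> a x y; exact: (linearP g (pi a)).
have fL : linear (f : P -> restr_mod N).
  by move=> a x y; rewrite (quo_scaleE IP); exact: (linearP f (pi a)).
have [h hE] := Pp _ _ (lin_of gL) (lin_of fL)
  (@killed_restr_mod M) (@killed_restr_mod N) g_onto.
have hL : linear (h : quo_mod IP -> M).
  move=> c x y; rewrite -(pi_repr c) -quo_scaleE; exact: (linearP h).
by exists (lin_of hL).
Qed.

(** Dimension shifting: Ext^{n+1} of a j-th syzygy of M is Ext^{j+n+1} of M. The induction on [j]
    raises [n] at each step. *)
Lemma syz_annihilates_Ext (c : Q) j n K (IK : killed I K) :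
  noetherian R -> ca (j + n.+1) c -> iter j (Om I) (md I) K ->
  forall N : lmodType Q, fin_gen N -> annihilates_Ext c n.+1 (quo_mod IK) N.
Proof.
move=> noethR; elim: j n K IK => [|j IHj] n K IK cj.
  by move=> [_ fK] N fN; apply: cj => //; apply: quo_fin_gen.
move=> [M [Mj MK]] N fN; have [P [i [q [Pp iq]]]] := MK.
have IP : killed I P by case: Pp => -[].
have IM : killed I M by apply: (@killed_onto _ _ _ _ q) IP; case: iq.
apply: (@annihilates_Ext_shift _ _ _ (quo_mod IM) _ _
  (quo_lin IK IP i) (quo_lin IP IM q)) => //.
  by apply: quo_projective; case: Pp.
by apply: IHj => //; rewrite addnS.
Qed.

(** For the kernel [K] of [q], Ext^1(N, K) is a shifted Ext^{m+1}, hence annihilated by [c]. Over R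
    a representative of [c] acts in its place. *)
Lemma syz_factor (c : Q) m N F (q : {linear F -> N}) :
  noetherian R -> ca m.+1 c -> iter m (Om I) (md I) N -> killed I N -> pj I F -> onto q ->
  exists h : {linear N -> F}, forall x : N, q (h x) = repr c *: x.
Proof.
move=> noethR cm Nm IN Fp q_onto.
have [K [k [k_inj kq]]] := exists_ker q.
have IF : killed I F by case: Fp => -[].
have Km : md I K by apply: md_inj k_inj Fp.1.
have [||||h hE] := @annihilates_Ext1_factor _ c (quo_mod IN) (quo_mod Km.1) (quo_mod IF)
   (quo_lin Km.1 IF k) (quo_lin IF IN q).
- by apply: quo_projective; case: Fp.
- by [].
- by apply: exists_resolution; [exact: noetherian_quot|apply: quo_fin_gen; case: Km].
- by apply: (@syz_annihilates_Ext _ m) => //; [rewrite addn1|apply: quo_fin_gen; case: Km].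
exists (lin_of (@unquo_linear N F IN IF h)) => x.
by rewrite (quo_scaleE IN) pi_repr; exact: hE.
Qed.
End PrimeQuotient.

(** * Chains of primes above an ideal *)

Section PrimeChains.
Variable R : comNzRingType.
Implicit Types I J : set R.

Definition is_prime I := [/\ is_ideal I, ~ I 1 & forall x y, I (x * y) -> I x \/ I y].

Lemma is_prime_idealr I : is_prime I ->
  exists p : prime_idealr R, forall x, x \in p <-> I x.
Proof.
move=> [[I0 ID IM] I1 IP].
pose S : {pred R} := fun x => `[< I x >].
have SE x : x \in S <-> I x by split=> /asboolP.
have SI : idealr_closed S.
  split=> [||a x y /SE Ix /SE Iy]; first exact/SE.
    by apply/negP => /SE.
  by apply/SE/ID => //; apply: IM.
have SP : prime_idealr_closed S.
  by move=> x y /SE /IP [] /SE ->; rewrite ?orbT.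
by exists (HB.pack_for (prime_idealr R) (S : R -> bool) (isIdealr.Build R S SI)
    (isPrimeIdealrClosed.Build R S SP)).
Qed.

Lemma is_prime_ideal_of I : is_prime I -> exists p : prime_idealr R, I = ideal_of p.
Proof.
by move=> /is_prime_idealr [p pE]; exists p; apply/predeqP => x; rewrite -pE.
Qed.

(* Chains of length n in the spectrum of R/I. *)
Definition chain_above I (n : nat) :=
  exists q : 'I_n.+1 -> prime_idealr R,
    (forall i x, I x -> x \in q i) /\
    forall i j : 'I_n.+1, (i < j)%N ->
      {subset q i <= q j} /\ exists2 x, x \in q j & x \notin q i.

Lemma chain_above_sub I J n : (I `<=` J)%classic -> chain_above J n -> chain_above I n.
Proof.
by move=> IJ [q [Jq qq]]; exists q; split=> // i x /IJ; apply: Jq.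
Qed.

Lemma chain_above_self (p : prime_idealr R) : chain_above (ideal_of p) 0.
Proof.
by exists (fun _ => p); split=> // i j; rewrite !ord1.
Qed.

(** [p] goes in front of the chain; [a] separates it from the first prime. *)
Lemma chain_above_cons (p : prime_idealr R) (a : R) n : a \notin p ->
  chain_above (add_elt (ideal_of p) a) n -> chain_above (ideal_of p) n.+1.
Proof.
move=> nap [q [pq qq]].
exists (fun i => if unlift ord0 i is Some j then q j else p); split=> [i x px|i j].
  by case: unliftP => // k _; apply: pq; apply: sub_add_elt.
case: (unliftP ord0 j) => [j' ->|->]; last by rewrite ltn0.
case: (unliftP ord0 i) => [i' ->|->]; first by rewrite !lift0 ltnS; apply: qq.
move=> _; split=> [x px|]; first by apply: pq; apply: sub_add_elt.
exists a => //; apply: pq; apply: mem_add_elt; exact: ideal_of_ideal.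
Qed.

End PrimeChains.

(** * Primes and Krull dimension of R/p *)

Section QuotientChains.
Local Open Scope quotient_scope.
Variables (R : comNzRingType) (p : prime_idealr R).
Local Notation Q := {ideal_quot p}.

Lemma prime_pull (q : prime_idealr Q) :
  exists q' : prime_idealr R, forall x, x \in q' <-> \pi_Q x \in q.
Proof.
apply: (@is_prime_idealr R [set x | \pi_Q x \in q]%classic); split; [split| |].
- by rewrite /= pi0 rpred0.
- by move=> x y /= xq yq; rewrite piD rpredD.
- by move=> a x /= xq; rewrite piM idealMr.
- by rewrite /= pi1 idealr1.
- by move=> x y /=; rewrite piM prime_idealrM => /orP.
Qed.

Lemma prime_push (q : prime_idealr R) : {subset p <= q} ->
  exists q' : prime_idealr Q, forall x, \pi_Q x \in q' <-> x \in q.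
Proof.
move=> pq; pose S : set Q := [set c | repr c \in q]%classic.
have SE x : S (\pi_Q x) <-> x \in q.
  have pqx : repr (\pi_Q x) - x \in q by apply/pq/pi_eq; rewrite pi_repr.
  by rewrite /S /= -[x in _ <-> x \in _](subKr (repr (\pi_Q x))) rpredBr.
have [|q' q'E] := @is_prime_idealr Q S; last by exists q' => x; rewrite q'E.
split; [split| |].
- by rewrite -pi0; apply/SE; rewrite rpred0.
- move=> x y; rewrite -(pi_repr x) -(pi_repr y) -piD => /SE xq /SE yq.
  by apply/SE; rewrite rpredD.
- move=> a x; rewrite -(pi_repr x) -(pi_repr a) -piM => /SE xq.
  by apply/SE; rewrite idealMr.
- by rewrite -pi1 => /SE; rewrite idealr1.
- move=> x y; rewrite -(pi_repr x) -(pi_repr y) -piM => /SE.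
  by rewrite prime_idealrM => /orP [] /SE; [left|right].
Qed.

Lemma prime_chain_quot n : prime_chain Q n <-> chain_above (ideal_of p) n.
Proof.
split=> [[q qq]|[q [pq qq]]].
  have /choice [q' q'E] := fun i => prime_pull (q i).
  exists q'; split=> [i x px|i j /qq [qij [c cj ci]]].
    by apply/q'E; rewrite (pi_eq0 _ _).2 // rpred0.
  split=> [x /q'E /qij /q'E //|]; exists (repr c); first by apply/q'E; rewrite pi_repr.
  by apply: contra ci => /q'E; rewrite pi_repr.
have /choice [q' q'E] := fun i => prime_push (pq i).
exists q' => i j /qq [qij [x xj xi]].
split=> [c|]; first by rewrite -(pi_repr c) => /q'E /qij /q'E.
by exists (\pi_Q x); [apply/q'E|apply: contra xi => /q'E].
Qed.

(** The hypothesis on [ca] speaks of the exact dimension of R/p, while the induction carries an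
    upper bound. A maximum exists because [p] alone is a chain of length 0. *)
Lemma exists_krull_dim m : (forall n, chain_above (ideal_of p) n -> (n <= m)%N) ->
  exists k, (k <= m)%N /\ has_krull_dim Q k.
Proof.
move=> pm; pose P n := `[< prime_chain Q n >].
have exP : exists n, P n.
  by exists 0%N; apply/asboolP/prime_chain_quot/chain_above_self.
have Pm n : P n -> (n <= m)%N by move=> /asboolP /prime_chain_quot /pm.
case: (ex_maxnP exP Pm) => k Pk kmax; exists k; split; first exact: Pm.
split=> [|n Qn]; first exact/asboolP.
by apply: kmax; apply/asboolP.
Qed.
End QuotientChains.

(** * Primes above a proper ideal *)

Section PrimeAbove.
Variable R : comNzRingType.
Implicit Types I : set R.
Hypothesis noethR : noetherian R.

Lemma prime_or_split I : is_ideal I -> [\/ I 1, is_prime I |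
  exists x y, [/\ ~ I x, ~ I y & I (x * y)]].
Proof.
move=> II; have [I1|I1] := pselect (I 1); first by constructor 1.
have [h|h] := pselect (exists x y, [/\ ~ I x, ~ I y & I (x * y)]).
  by constructor 3.
constructor 2; split=> // x y Ixy; apply: contrapT => /not_orP [nx ny].
by apply: h; exists x, y.
Qed.

(** Noetherian induction: if [x * y] lies in [I] and both I + (x) and I + (y) contained 1, the
    product of the two expressions of 1 would put 1 in [I]. *)
Lemma exists_prime_above I : is_ideal I -> ~ I 1 -> chain_above I 0.
Proof.
apply: (noetherian_ind (P := fun I => ~ I 1 -> chain_above I 0)) => // {}I II IHI I1.
have [//|/is_prime_ideal_of [p ->]|[x [y [nx ny Ixy]]]] := prime_or_split II.
  exact: chain_above_self.
have step z : ~ I z -> ~ add_elt I z 1 -> chain_above I 0.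
  move=> nz z1; apply: chain_above_sub (@sub_add_elt _ I z) _.
  by apply: IHI => //; [apply: add_elt_ideal|apply: proper_add_elt].
have [x1|/(step _ nx) //] := pselect (add_elt I x 1).
have [y1|/(step _ ny) //] := pselect (add_elt I y 1).
have [I0 ID IM] := II; case: I1.
have [u [r [Iu uE]]] := x1; have [v [s [Iv vE]]] := y1.
have -> : 1 = (v + s * y) * u + (r * x) * v + (r * s) * (x * y).
  rewrite -vE mul1r {1}uE -addrA; congr (_ + _).
  by rewrite -[r * x]mulr1 {1}vE mulrDr mulr1 mulrACA.
by apply: (ID); [apply: ID|]; apply: IM.
Qed.
End PrimeAbove.

(** * The noetherian induction *)

Section Main.
Variable R : comNzRingType.
Hypothesis noethR : noetherian R.
Hypothesis H : forall (p : prime_idealr R) (m : nat),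
  has_krull_dim {ideal_quot p} m ->
  exists s : nat, (s <= m + 1)%N /\ exists2 a : {ideal_quot p}, ca s a & a != 0.
Implicit Types M N K P : lmodType R.
Implicit Types I J : set R.

Lemma killed_unit I M : I 1 -> killed I M -> forall x : M, x = 0.
Proof. by move=> I1 IM x; rewrite -[x]scale1r IM. Qed.

Lemma bounded_zero I (C : lmodType R -> Prop) :
  (forall M, C M -> forall x : M, x = 0) -> bounded I C.
Proof.
move=> C0; exists {ffun 'I_0 -> R^o}, 0%N; split=> //.
by apply: md_zero => x; apply/ffunP => -[].
Qed.

Lemma bounded_syz_split I x y j : is_ideal I -> I (x * y) ->
  bounded_syz (add_elt I x) j (md (add_elt I x)) ->
  bounded_syz (add_elt I y) j (md (add_elt I y)) ->
  bounded_syz I j (md I).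
Proof.
move=> II Ixy xb yb.
have base z : bounded_syz (add_elt I z) j (md (add_elt I z)) ->
    bounded_syz I j (md (add_elt I z)).
  move=> zb; apply: (bounded_syz_base_change noethR II (add_elt_ideal z II)) => //.
    exact: sub_add_elt.
  exact: bounded_sub (@sub_add_elt _ I z) zb.
have mdI z : subclass (md (add_elt I z)) (md I).
  by move=> M; apply: md_sub; apply: sub_add_elt.
apply: bounded_syz_subclass
  (bounded_syz_extensions noethR II (mdI y) (mdI x) (base y yb) (base x xb)).
move=> M Mm; split; first by case: Mm.
have [N [q qN]] := exists_coker_scale x M.
have [K [i [i_inj iq]]] := exists_ker q.
exists K, N, i, q; split; last exact: coker_scale_md qN Mm.
  by split=> //; case: qN.
have [IK fK] := md_inj noethR i_inj Mm; split=> //.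
apply: killed_add_elt => // k; apply: i_inj; rewrite linear0 linearZZ.
have [|z ->] := (qN.2 (i k)).1; first by apply/iq; exists k.
by rewrite scalerA mulrC; case: Mm => IM _; apply: IM.
Qed.

Lemma bounded_syz_prime (p : prime_idealr R) m :
  (forall a, a \notin p -> forall j,
    (forall n, chain_above (add_elt (ideal_of p) a) n -> (n <= j)%N) ->
    bounded_syz (add_elt (ideal_of p) a) j (md (add_elt (ideal_of p) a))) ->
  (forall n, chain_above (ideal_of p) n -> (n <= m)%N) ->
  bounded_syz (ideal_of p) m (md (ideal_of p)).
Proof.
move=> IH pm; set I := ideal_of p; have II : is_ideal I := ideal_of_ideal p.
have [k [km dimp]] := exists_krull_dim pm.
(* It is enough to treat the exact dimension [k], for which the hypothesis provides [c]. *)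
apply: (bounded_syz_le noethR II km).
have [s [sk [c cs c0]]] := H dimp.
(* [ca] grows with its index, so [s] can be raised to [k + 1]. *)
have ck : ca k.+1 c.
  by move=> M N fM fN i ki; apply: cs => //; apply: leq_trans ki; rewrite -addn1.
pose a := repr c.
have ap : a \notin p.
  by apply: contra c0 => /pi_eq0; rewrite pi_repr => ->.
have aI x : I (a * x) -> I x by rewrite /I /ideal_of /= prime_idealrM (negPf ap).
set J := add_elt I a; have JJ : is_ideal J := add_elt_ideal a II.
have chainJ n : chain_above J n -> (n < k)%N.
  by move=> /(chain_above_cons ap) /prime_chain_quot; apply: dimp.2.
have regb : (forall N, iter k (Om I) (md I) N -> regular_on a N) /\
    bounded I (Coker a (iter k (Om I) (md I))).
  case: k {km dimp sk ck} chainJ => [|k] chainJ.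
    (* Dimension 0: no prime contains [J], so [J] is the unit ideal. Then [a] is invertible on
       modules killed by [I], and the cokernels vanish. *)
    have J1 : J 1.
      by apply: contrapT => /(exists_prime_above noethR JJ) /chainJ.
    split=> [N [IN _] x ax|].
      have [y [r [Iy yE]]] := J1.
      by rewrite -[x]scale1r yE scalerDl IN // -scalerA ax scaler0 addr0.
    apply: bounded_zero => N [M [q [Mm qN]]].
    by apply: killed_unit J1 _; case: (coker_scale_md qN Mm).
  have Om_reg j N : iter j.+1 (Om I) (md I) N -> regular_on a N.
    move=> [M [_ [P [i [q [Pp [i_inj _ _]]]]]]].
    exact: regular_on_inj i_inj (regular_on_pj II aI Pp).
  split; first exact: Om_reg.
  have Jb : bounded_syz J k (md J) by apply: IH => // n /chainJ; rewrite ltnS.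
  apply: bounded_sub (@sub_add_elt _ I a) _; apply: bounded_subclass Jb.
  (* The first syzygy taken is split off, so that [a] is regular where the reduction starts; the [k]
     remaining ones become syzygies over R/J, within reach of the induction. *)
  rewrite iterSr => N /(coker_scale_iter_syz II aI (Om_reg 0%N)).
  apply: iter_Om_subclass => {}N [M [q [/(Om_md noethR) Mm qN]]].
  exact: coker_scale_md qN Mm.
have [reg cokb] := regb.
(* The kernel of F -> N/aN is a syzygy of N/aN over R/p, so the bound on the cokernels passes to the
   modules [N]. *)
apply: bounded_subclass (bounded_retracts (bounded_Om noethR II cokb)) => N Nk.
have Nm : md I N.
  by case: {regb reg cokb chainJ km dimp sk ck} k Nk => [//|k] /(Om_md noethR).
have [F [q [Fp q_onto]]] := exists_pj_cover II Nm.
have [h hE] := syz_factor noethR ck Nk Nm.1 Fp q_onto.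
have [N' [t tN]] := exists_coker_scale a N.
have [E [_ [<- NE] ?]] := retract_syz_coker Fp q_onto hE (reg N Nk) tN.
by exists E => //; exists N'; split=> //; exists N, t.
Qed.

(** [m] is quantified inside the induction on [I]: the prime case uses a smaller bound for the
    larger ideals, the split case keeps [m]. *)
Lemma bounded_syz_dim I : is_ideal I ->
  forall m, (forall n, chain_above I n -> (n <= m)%N) -> bounded_syz I m (md I).
Proof.
move: I; apply: noetherian_ind noethR _ => I II IHI m Im.
have [I1|/is_prime_ideal_of [p pE]|[x [y [nx ny Ixy]]]] := prime_or_split II.
- apply: (bounded_syz_le noethR II (leq0n m)).
  by apply: bounded_zero => M [IM _]; apply: killed_unit IM.
- subst I; apply: bounded_syz_prime Im => a ap; apply: IHI.
    exact: add_elt_ideal.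
  by apply: proper_add_elt => //; apply/negP.
- apply: (bounded_syz_split II Ixy).
  + apply: IHI => [||n]; [exact: add_elt_ideal|exact: proper_add_elt|].
    by move=> /(chain_above_sub (@sub_add_elt _ I x)); apply: Im.
  + apply: IHI => [||n]; [exact: add_elt_ideal|exact: proper_add_elt|].
    by move=> /(chain_above_sub (@sub_add_elt _ I y)); apply: Im.
Qed.

Lemma nth_syzygy_iter d M K : fin_gen M -> nth_syzygy d M K ->
  iter d (Om (@zero_ideal R)) (md (@zero_ideal R)) K.
Proof.
move=> fM; elim: d K => [|d IHd] K /=.
  move=> /isomorphic_sym /isomorphic_retract /md_retract; apply.
  by split; first exact: killed_zero_ideal.
move=> [L [/IHd Ld [P [Pp fP [i [p ip]]]]]].
exists L; split=> //; exists P, i, p; split=> //.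
by split; [split=> //; apply: killed_zero_ideal|apply/rproj_zero_ideal].
Qed.
End Main.

Theorem theorem5p2 (R : comNzRingType) (d : nat)
    (noethR : noetherian R) (dimR : has_krull_dim R d)
    (H : forall (p : prime_idealr R) (m : nat),
       has_krull_dim {ideal_quot p} m ->
       exists s : nat, (s <= m + 1)%N /\
         exists2 a : {ideal_quot p}, ca s a & a != 0) :
  exists (G : lmodType R) (n : nat), fin_gen G /\
    forall K : lmodType R, Omega_mod d K -> gen_level G n K.
Proof.
have [|G [n [Gm Gn]]] :=
    bounded_syz_dim noethR H (@zero_ideal_ideal R) (m := d).
  by move=> n [q [_ qq]]; apply: dimR.2; exists q.
exists G, n; split; first by case: Gm.
move=> K [M [fM MK]]; apply: level_gen_level Gm _.
by apply: Gn; apply: nth_syzygy_iter MK.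
Qed.
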